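(* Let $(\boldsymbol{k},\Gamma)$ be a Hopf algebroid over a field $\boldsymbol{k}$. If the associated Hopf algebra $(\boldsymbol{k},\Gamma')$ is unipotent, then $(\boldsymbol{k},\Gamma)$ is unipotent.
   Context: A Hopf algebroid $(\boldsymbol{k},\Gamma)$ over a field is a cogroupoid object in commutative rings with object ring $\boldsymbol{k}$, with left and right units $\eta_L,\eta_R\colon\boldsymbol{k}\to\Gamma$, counit, coproduct $\psi\colon\Gamma\to\Gamma\otimes_{\boldsymbol{k}}\Gamma$ (bimodule tensor product) and antipode; $\eta_L$ and $\eta_R$ may differ. Comodules are left comodules with coaction $\rho\colon V\to\Gamma\otimes_{\boldsymbol{k}}V$; an element $x\in V$ is primitive if $\rho(x)=1\otimes x$. The Hopf algebroid is unipotent if every non-trivial comodule which is finite dimensional over $\boldsymbol{k}$ has non-trivial primitives. (The same definition applies to a Hopf algebra, which is a Hopf algebroid with $\eta_L=\eta_R$.) The associated Hopf algebra of $(\boldsymbol{k},\Gamma)$ is defined as follows. Let $D=\boldsymbol{k}\,\square_\Gamma\,\boldsymbol{k}=\{a\in\boldsymbol{k}:\eta_L(a)=\eta_R(a)\}$ and $\Phi=\boldsymbol{k}\otimes_D\boldsymbol{k}$, which maps to $\Gamma$ by $a\otimes b\mapsto\eta_L(a)\eta_R(b)$. Then $\Gamma'=\boldsymbol{k}\otimes_\Phi\Gamma$, where $\Phi\to\boldsymbol{k}$ is the multiplication; equivalently $\Gamma'$ is the quotient of $\Gamma$ by the ideal generated by all $\eta_L(a)-\eta_R(a)$, $a\in\boldsymbol{k}$,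 with the induced structure maps. *)

(* Defs.v *)
From HB Require Import structures.
From mathcomp Require Import all_boot all_algebra.
From mathcomp Require Import boolp.

Set Implicit Arguments.
Unset Strict Implicit.
Unset Printing Implicit Defensive.

Import GRing.Theory.
Local Open Scope ring_scope.

(* Tensor products.  [tensor ra la] is the quotient of the free abelian group *)
(* on M x N by biadditivity and (ra a x) (x) y = x (x) (la a y), where the    *)
(* index type K acts on M through ra and on N through la.  The actions are    *)
(* explicit because a ring Gamma with two units carries two k-module          *)
(* structures.  Elements are represented by lists of pairs (formal sums);     *)
(* [tens_eq0l] forces (- x, y) to be the opposite of (x, y), so the quotient  *)
(* of the free monoid is a group.                                             *)
Section Tensor.
Variables (K : Type) (M N : zmodType) (ra : K -> M -> M) (la : K -> N -> N).

Inductive tens_eq : seq (M * N) -> seq (M * N) -> Prop :=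
| tens_eq_refl s : tens_eq s s
| tens_eq_sym s t : tens_eq s t -> tens_eq t s
| tens_eq_trans s t u : tens_eq s t -> tens_eq t u -> tens_eq s u
| tens_eq_cat s s' t t' :
    tens_eq s s' -> tens_eq t t' -> tens_eq (s ++ t) (s' ++ t')
| tens_eqC s t : tens_eq (s ++ t) (t ++ s)
| tens_eq0l y : tens_eq [:: (0, y)] [::]
| tens_eqDl x x' y : tens_eq [:: (x + x', y)] [:: (x, y); (x', y)]
| tens_eqDr x y y' : tens_eq [:: (x, y + y')] [:: (x, y); (x, y')]
| tens_eq_bal a x y : tens_eq [:: (ra a x, y)] [:: (x, la a y)].

Definition tens_eqb : rel (seq (M * N)) := fun s t => `[< tens_eq s t >].

Fact tens_eqb_refl : reflexive tens_eqb.
Proof. by move=> s; apply/asboolP; apply: tens_eq_refl. Qed.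

Fact tens_eqb_sym : symmetric tens_eqb.
Proof. by move=> s t; apply: asbool_equiv_eq; split; apply: tens_eq_sym. Qed.

Fact tens_eqb_trans : transitive tens_eqb.
Proof.
move=> t s u /asboolP st /asboolP tu; apply/asboolP; exact: tens_eq_trans tu.
Qed.

Canonical tens_equiv := EquivRel tens_eqb tens_eqb_refl tens_eqb_sym
  tens_eqb_trans.

Definition tensor := {eq_quot tens_equiv}%qT.

HB.instance Definition _ := Choice.on tensor.

Definition tclass (s : seq (M * N)) : tensor := (\pi_({eq_quot tens_equiv}) s)%qT.
Definition trepr (t : tensor) : seq (M * N) := (repr t)%qT.

Lemma treprK : cancel trepr tclass.
Proof. by move=> t; rewrite /tclass /trepr reprK. Qed.

Lemma tclassP s t : tclass s = tclass t <-> tens_eq s t.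
Proof. by split=> [/eqmodP/asboolP | st]; last exact/eqmodP/asboolP. Qed.

Lemma tclass_repr s : tens_eq (trepr (tclass s)) s.
Proof. by apply/tclassP; rewrite treprK. Qed.

Definition tens_pure (x : M) (y : N) : tensor := tclass [:: (x, y)].
Definition tens_add (s t : tensor) : tensor := tclass (trepr s ++ trepr t).
Definition tens_opp (t : tensor) : tensor :=
  tclass [seq (- p.1, p.2) | p <- trepr t].

Lemma tclass_cat s t : tens_add (tclass s) (tclass t) = tclass (s ++ t).
Proof. by apply/tclassP/tens_eq_cat; apply: tclass_repr. Qed.

Fact tens_addA : associative tens_add.
Proof.
move=> s t u; rewrite -[s]treprK -[t]treprK -[u]treprK.
by rewrite !tclass_cat catA.
Qed.

Fact tens_addC : commutative tens_add.
Proof. by move=> s t; apply/tclassP/tens_eqC. Qed.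

Fact tens_add0 : left_id (tclass [::]) tens_add.
Proof. by move=> t; rewrite -[t]treprK tclass_cat. Qed.

Fact tens_addN : left_inverse (tclass [::]) tens_opp tens_add.
Proof.
move=> t; rewrite -{2}[t]treprK /tens_opp tclass_cat; apply/tclassP.
elim: (trepr t) => [|[x y] s IHs] /=; first exact: tens_eq_refl.
set s' := map _ s in IHs *.
apply: (@tens_eq_trans _ ([:: (- x, y)] ++ ((x, y) :: s) ++ s')).
  apply: (@tens_eq_cat [:: (- x, y)] [:: (- x, y)]); first exact: tens_eq_refl.
  exact: tens_eqC.
apply: (@tens_eq_trans _ ([::] ++ (s ++ s'))).
  rewrite -[_ ++ _]/([:: (- x, y); (x, y)] ++ (s ++ s')).
  apply: tens_eq_cat; last exact: tens_eq_refl.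
  apply: tens_eq_trans (tens_eq0l y); apply: tens_eq_sym.
  by rewrite -(addNr x); apply: tens_eqDl.
exact: tens_eq_trans (tens_eqC s s') IHs.
Qed.

HB.instance Definition _ :=
  GRing.isZmodule.Build tensor tens_addA tens_addC tens_add0 tens_addN.

Lemma tclassD s t : tclass (s ++ t) = tclass s + tclass t.
Proof. by rewrite -tclass_cat. Qed.

Lemma tclass_sum s : tclass s = \sum_(p <- s) tens_pure p.1 p.2.
Proof.
elim: s => [|[x y] s IHs]; first by rewrite big_nil.
by rewrite big_cons -IHs -tclassD.
Qed.

Lemma tens_pureDl x x' y :
  tens_pure (x + x') y = tens_pure x y + tens_pure x' y.
Proof. by rewrite -tclassD; apply/tclassP/tens_eqDl. Qed.

Lemma tens_pureDr x y y' :
  tens_pure x (y + y') = tens_pure x y + tens_pure x y'.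
Proof. by rewrite -tclassD; apply/tclassP/tens_eqDr. Qed.

Lemma tens_pure_bal a x y : tens_pure (ra a x) y = tens_pure x (la a y).
Proof. exact/tclassP/tens_eq_bal. Qed.

Lemma tens_ind (P : tensor -> Prop) :
  P 0 -> (forall x y t, P t -> P (tens_pure x y + t)) -> forall t, P t.
Proof.
move=> P0 PD t; rewrite -[t]treprK tclass_sum.
elim: (trepr t) => [|p s IHs]; first by rewrite big_nil.
by rewrite big_cons; apply: PD.
Qed.

Record balanced (A : zmodType) (f : M -> N -> A) : Prop := Balanced {
  balDl : forall x x' y, f (x + x') y = f x y + f x' y;
  balDr : forall x y y', f x (y + y') = f x y + f x y';
  bal_act : forall a x y, f (ra a x) y = f x (la a y)
}.

(* The additive map on the tensor product induced by f; it is meaningful when *)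
(* f is balanced (see [tliftE]), as are all the f it is applied to below.     *)
Definition tlift (A : zmodType) (f : M -> N -> A) (t : tensor) : A :=
  \sum_(p <- trepr t) f p.1 p.2.

Section Lift.
Variables (A : zmodType) (f : M -> N -> A).
Hypothesis fB : balanced f.

Lemma tlift_class s : tlift f (tclass s) = \sum_(p <- s) f p.1 p.2.
Proof.
have f0 y : f 0 y = 0.
  by apply: (addrI (f 0 y)); rewrite -(balDl fB) !addr0.
rewrite /tlift; move: (trepr _) (tclass_repr s) => t; elim=> {s t} //=.
- by move=> s1 s2 s3 _ -> _ ->.
- by move=> s1 s2 t1 t2 _ e1 _ e2; rewrite !big_cat /= e1 e2.
- by move=> s1 s2; rewrite !big_cat /= addrC.
- by move=> y; rewrite big_seq1 big_nil f0.
- by move=> x x' y; rewrite !big_cons !big_nil !addr0 (balDl fB).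
- by move=> x y y'; rewrite !big_cons !big_nil !addr0 (balDr fB).
- by move=> a x y; rewrite !big_seq1 (bal_act fB).
Qed.

Lemma tliftE x y : tlift f (tens_pure x y) = f x y.
Proof. by rewrite tlift_class big_seq1. Qed.

Lemma tliftD s t : tlift f (s + t) = tlift f s + tlift f t.
Proof.
rewrite -[s]treprK -[t]treprK -tclassD !tlift_class.
by rewrite big_cat.
Qed.

Lemma tlift0 : tlift f 0 = 0.
Proof. by rewrite -[0]/(tclass [::]) tlift_class big_nil. Qed.

End Lift.

Lemma eq_tlift (A : zmodType) (f g : M -> N -> A) :
  f =2 g -> tlift f =1 tlift g.
Proof. by move=> fg t; apply: eq_bigr => p _; apply: fg. Qed.

Lemma tens_pure_balanced : balanced tens_pure.
Proof.
split; [exact: tens_pureDl | exact: tens_pureDr | exact: tens_pure_bal].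
Qed.

Lemma tens_ext (A : zmodType) (u v : tensor -> A) :
    {morph u : s t / s + t} -> {morph v : s t / s + t} ->
    (forall x y, u (tens_pure x y) = v (tens_pure x y)) -> u =1 v.
Proof.
move=> uD vD uv; apply: tens_ind => [|x y t IHt]; last by rewrite uD vD uv IHt.
have z0 (w : tensor -> A) : {morph w : s t / s + t} -> w 0 = 0.
  by move=> wD; apply: (addrI (w 0)); rewrite -wD !addr0.
by rewrite !z0.
Qed.

End Tensor.

Arguments tens_pure {K M N ra la} x y.

Notation "x ⊗ y" := (tens_pure x y) (at level 39, left associativity).

(* The tensor product of commutative rings A and B over K, where K acts by    *)
(* multiplication through f : K -> A and g : K -> B.                          *)
Section RingTensor.
Variables (K : Type) (A B : comPzRingType) (f : K -> A) (g : K -> B).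

Definition rtensor : Type :=
  tensor (fun (a : K) (x : A) => x * f a) (fun (a : K) (y : B) => g a * y).

HB.instance Definition _ := GRing.Zmodule.on rtensor.

Implicit Types s t u : rtensor.

Definition rtens_mul_pure (x : A) (y : B) : rtensor -> rtensor :=
  tlift (fun x' y' => (x * x') ⊗ (y * y') : rtensor).

Definition rtens_mul s t : rtensor :=
  tlift (fun x y => rtens_mul_pure x y t) s.

Definition rtens_one : rtensor := 1 ⊗ 1.

Lemma rtens_mul_pure_bal x y : balanced (fun (a : K) (x : A) => x * f a)
  (fun (a : K) (y : B) => g a * y) (fun x' y' => (x * x') ⊗ (y * y') : rtensor).
Proof.
split=> [x1 x2 y1|x1 y1 y2|a x1 y1].
- by rewrite mulrDr tens_pureDl.
- by rewrite mulrDr tens_pureDr.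
- by rewrite mulrA tens_pure_bal mulrCA.
Qed.

Lemma rtens_mul_pureE x y x' y' :
  rtens_mul_pure x y (x' ⊗ y') = (x * x') ⊗ (y * y').
Proof. exact: tliftE (rtens_mul_pure_bal x y) x' y'. Qed.

Lemma rtens_mul_pureD x y s t :
  rtens_mul_pure x y (s + t) = rtens_mul_pure x y s + rtens_mul_pure x y t.
Proof. exact: tliftD (rtens_mul_pure_bal x y) s t. Qed.

Lemma rtens_mul_bal t : balanced (fun (a : K) (x : A) => x * f a)
  (fun (a : K) (y : B) => g a * y) (fun x y => rtens_mul_pure x y t).
Proof.
split=> [x1 x2 y|x y1 y2|a x y]; move: t; apply: tens_ext => [s t|s t|x' y'];
  rewrite ?rtens_mul_pureD ?rtens_mul_pureE //.
- by rewrite addrACA.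
- by rewrite mulrDl tens_pureDl.
- by rewrite addrACA.
- by rewrite mulrDl tens_pureDr.
- by rewrite mulrAC tens_pure_bal mulrA.
Qed.

Lemma rtens_mulE x y t : rtens_mul (x ⊗ y) t = rtens_mul_pure x y t.
Proof. exact: tliftE (rtens_mul_bal t) x y. Qed.

Lemma rtens_mulDl : left_distributive rtens_mul +%R.
Proof. by move=> s t u; apply: tliftD (rtens_mul_bal u) s t. Qed.

Lemma rtens_mulDr s : {morph rtens_mul s : t u / t + u}.
Proof.
move=> t u; move: s; apply: tens_ext => [s1 s2|s1 s2|x y].
- by rewrite rtens_mulDl.
- by rewrite !rtens_mulDl addrACA.
- by rewrite !rtens_mulE rtens_mul_pureD.
Qed.

Fact rtens_mulC : commutative rtens_mul.
Proof.
move=> s t; move: s; apply: tens_ext => [s1 s2|s1 s2|x y].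
- by rewrite rtens_mulDl.
- by rewrite rtens_mulDr.
move: t; apply: tens_ext => [t1 t2|t1 t2|x' y'].
- by rewrite rtens_mulDr.
- by rewrite rtens_mulDl.
- by rewrite !rtens_mulE !rtens_mul_pureE mulrC [y * _]mulrC.
Qed.

Fact rtens_mulA : associative rtens_mul.
Proof.
move=> s t u; move: s; apply: tens_ext => [s1 s2|s1 s2|x y];
  rewrite ?rtens_mulDl //.
move: t; apply: tens_ext => [t1 t2|t1 t2|x' y'].
- by rewrite rtens_mulDl rtens_mulDr.
- by rewrite rtens_mulDr rtens_mulDl.
move: u; apply: tens_ext => [t1 t2|t1 t2|x2 y2]; rewrite ?rtens_mulDr //.
by rewrite !(rtens_mulE, rtens_mul_pureE) !mulrA.
Qed.

Fact rtens_mul1 : left_id rtens_one rtens_mul.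
Proof.
apply: tens_ext => [s t|s t|x y] //; first by rewrite rtens_mulDr.
by rewrite rtens_mulE rtens_mul_pureE !mul1r.
Qed.

HB.instance Definition _ := GRing.Zmodule_isComPzRing.Build rtensor
  rtens_mulA rtens_mulC rtens_mul1 rtens_mulDl.

Lemma rtensM x y x' y' :
  (x ⊗ y : rtensor) * (x' ⊗ y') = (x * x') ⊗ (y * y').
Proof. by rewrite -rtens_mul_pureE -rtens_mulE. Qed.

Lemma rtens1 : 1 = 1 ⊗ 1 :> rtensor.
Proof. by []. Qed.

Definition rinl (x : A) : rtensor := x ⊗ 1.
Definition rinr (y : B) : rtensor := 1 ⊗ y.

Fact rinl_is_additive : zmod_morphism rinl.
Proof.
move=> x y; apply: (addIr (rinl y)).
by rewrite subrK /rinl -tens_pureDl subrK.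
Qed.
Fact rinl_is_monoid : monoid_morphism rinl.
Proof. by split=> // x y; rewrite rtensM mulr1. Qed.
HB.instance Definition _ := GRing.isZmodMorphism.Build _ _ rinl rinl_is_additive.
HB.instance Definition _ := GRing.isMonoidMorphism.Build _ _ rinl rinl_is_monoid.

Fact rinr_is_additive : zmod_morphism rinr.
Proof.
move=> x y; apply: (addIr (rinr y)).
by rewrite subrK /rinr -tens_pureDr subrK.
Qed.
Fact rinr_is_monoid : monoid_morphism rinr.
Proof. by split=> // x y; rewrite rtensM mulr1. Qed.
HB.instance Definition _ := GRing.isZmodMorphism.Build _ _ rinr rinr_is_additive.
HB.instance Definition _ := GRing.isMonoidMorphism.Build _ _ rinr rinr_is_monoid.

Lemma rtens_split x y : x ⊗ y = rinl x * rinr y.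
Proof. by rewrite rtensM mulr1 mul1r. Qed.

Lemma rinlr a : rinl (f a) = rinr (g a).
Proof.
by rewrite /rinl /rinr -[f a]mul1r tens_pure_bal mulr1.
Qed.

Section Copair.
Variables (R : comPzRingType) (u : {rmorphism A -> R}) (v : {rmorphism B -> R}).

Definition copair of (forall a, u (f a) = v (g a)) : rtensor -> R :=
  tlift (fun x y => u x * v y).

Hypothesis uv : forall a, u (f a) = v (g a).

Lemma copair_bal : balanced (fun (a : K) (x : A) => x * f a)
  (fun (a : K) (y : B) => g a * y) (fun x y => u x * v y).
Proof.
split=> [x1 x2 y|x y1 y2|a x y].
- by rewrite rmorphD mulrDl.
- by rewrite rmorphD mulrDr.
- by rewrite !rmorphM uv mulrA.
Qed.

Lemma copairE x y : copair uv (x ⊗ y) = u x * v y.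
Proof. exact: tliftE copair_bal x y. Qed.

Lemma copairD s t : copair uv (s + t) = copair uv s + copair uv t.
Proof. exact: tliftD copair_bal s t. Qed.

Fact copair_is_additive : zmod_morphism (copair uv).
Proof.
by move=> s t; apply: (addIr (copair uv t)); rewrite -copairD !subrK.
Qed.

Fact copair_is_monoid : monoid_morphism (copair uv).
Proof.
split=> [|s t]; first by rewrite rtens1 copairE !rmorph1 mulr1.
move: s; apply: tens_ext => [s1 s2|s1 s2|x y].
- by rewrite mulrDl copairD.
- by rewrite copairD mulrDl.
move: t; apply: tens_ext => [t1 t2|t1 t2|x' y'].
- by rewrite mulrDr copairD.
- by rewrite copairD mulrDr.
- by rewrite rtensM !copairE !rmorphM mulrACA.
Qed.

HB.instance Definition _ :=
  GRing.isZmodMorphism.Build _ _ (copair uv) copair_is_additive.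
HB.instance Definition _ :=
  GRing.isMonoidMorphism.Build _ _ (copair uv) copair_is_monoid.

End Copair.

End RingTensor.

Arguments rinl {K A B f g} x.
Arguments rinr {K A B f g} y.

(* The remaining groupoid identity, chi (chi z) = z, follows from the others. *)
Record hopfAlgebroid (k : fieldType) := HopfAlgebroid {
  Gamma :> comPzRingType;
  etaL : {rmorphism k -> Gamma};
  etaR : {rmorphism k -> Gamma};
  counit : {rmorphism Gamma -> k};
  coprod : {rmorphism Gamma -> rtensor etaR etaL};
  antipode : {rmorphism Gamma -> Gamma};
  counit_etaL : forall a, counit (etaL a) = a;
  counit_etaR : forall a, counit (etaR a) = a;
  coprod_etaL : forall a, coprod (etaL a) = etaL a ⊗ 1;
  coprod_etaR : forall a, coprod (etaR a) = 1 ⊗ etaR a;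
  counit_coprodl : forall z,
    tlift (fun x y => etaL (counit x) * y) (coprod z) = z;
  counit_coprodr : forall z,
    tlift (fun x y => x * etaR (counit y)) (coprod z) = z;
  (* in Gamma (x)_k (Gamma (x)_k Gamma); the left k-module structure of the   *)
  (* second factor is multiplication by etaL a (x) 1                          *)
  coprodA : forall z,
    tlift (fun x y => tlift (fun x1 x2 =>
        x1 ⊗ (x2 ⊗ y) : rtensor etaR (fun a => etaL a ⊗ 1 : rtensor etaR etaL))
      (coprod x)) (coprod z)
    = tlift (fun x y => x ⊗ coprod y) (coprod z);
  antipode_etaL : forall a, antipode (etaL a) = etaR a;
  antipode_etaR : forall a, antipode (etaR a) = etaL a;
  antipodel : forall z,
    tlift (fun x y => antipode x * y) (coprod z) = etaR (counit z);
  antipoder : forall z,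
    tlift (fun x y => x * antipode y) (coprod z) = etaL (counit z)
}.

Section Comodule.
Variables (k : fieldType) (H : hopfAlgebroid k).

(* Gamma (x)_k V, with Gamma a right k-module through etaR; as a k-module it  *)
(* carries the left action of k through etaL.                                 *)
Section CoTensor.
Variable V : lmodType k.

Definition cotensor : Type :=
  tensor (fun (a : k) (x : H) => x * etaR H a) (fun (a : k) (v : V) => a *: v).

HB.instance Definition _ := GRing.Zmodule.on cotensor.

Definition cotens_scale (a : k) (t : cotensor) : cotensor :=
  tlift (fun x v => (etaL H a * x) ⊗ v : cotensor) t.

Lemma cotens_scale_bal a : balanced (fun (a : k) (x : H) => x * etaR H a)
  (fun (a : k) (v : V) => a *: v) (fun x v => (etaL H a * x) ⊗ v : cotensor).
Proof.
split=> [x x' v|x v v'|b x v].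
- by rewrite mulrDr tens_pureDl.
- by rewrite tens_pureDr.
- by rewrite mulrA tens_pure_bal.
Qed.

Lemma cotens_scaleE a x v : cotens_scale a (x ⊗ v) = (etaL H a * x) ⊗ v.
Proof. exact: tliftE (cotens_scale_bal a) x v. Qed.

Fact cotens_scaleDr : right_distributive cotens_scale +%R.
Proof. by move=> a s t; apply: tliftD (cotens_scale_bal a) s t. Qed.

Fact cotens_scaleA a b t :
  cotens_scale a (cotens_scale b t) = cotens_scale (a * b) t.
Proof.
move: t; apply: tens_ext => [s t|s t|x v]; rewrite ?cotens_scaleDr //.
by rewrite !cotens_scaleE rmorphM mulrA.
Qed.

Fact cotens_scale1 : left_id 1 cotens_scale.
Proof.
apply: tens_ext => [s t|s t|x v] //; first by rewrite cotens_scaleDr.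
by rewrite cotens_scaleE rmorph1 mul1r.
Qed.

Fact cotens_scaleDl t : {morph cotens_scale^~ t : a b / a + b}.
Proof.
move=> a b; move: t; apply: tens_ext => [s t|s t|x v].
- by rewrite cotens_scaleDr.
- by rewrite !cotens_scaleDr addrACA.
- by rewrite !cotens_scaleE rmorphD mulrDl tens_pureDl.
Qed.

HB.instance Definition _ := GRing.Zmodule_isLmodule.Build k cotensor
  cotens_scaleA cotens_scale1 cotens_scaleDr cotens_scaleDl.

End CoTensor.

(* rho is a counital and coassociative left coaction; the second identity     *)
(* lives in Gamma (x)_k (Gamma (x)_k V).                                      *)
Record is_coaction (V : lmodType k) (rho : {linear V -> cotensor V}) : Prop :=
  IsCoaction {
    coaction_counit : forall v,
      tlift (fun x w => counit H x *: w) (rho v) = v;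
    coactionA : forall v,
      tlift (fun x w => tlift (fun x1 x2 =>
          x1 ⊗ (x2 ⊗ w : cotensor V) : cotensor (cotensor V))
        (coprod H x)) (rho v)
      = tlift (fun x w => x ⊗ rho w) (rho v)
  }.

Definition primitive (V : lmodType k) (rho : {linear V -> cotensor V}) (x : V) :=
  rho x = 1 ⊗ x.

Definition unipotent : Prop :=
  forall (V : vectType k) (rho : {linear V -> cotensor V}),
    is_coaction rho -> (exists v : V, v != 0) ->
  exists2 x : V, x != 0 & primitive rho x.

End Comodule.

Section Associated.
Variables (k : fieldType) (H : hopfAlgebroid k).

Definition unit_equalizer := {a : k | etaL H a == etaR H a}.

(* Phi = k (x)_D k, with its maps a (x) b |-> a * b and                       *)
(* a (x) b |-> etaL a * etaR b                                                *)
Definition Phi := rtensor (val : unit_equalizer -> k) (val : unit_equalizer -> k).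

Definition Phi_mul : {rmorphism Phi -> k} :=
  @copair _ _ _ (val : unit_equalizer -> k) val k idfun idfun (fun=> erefl).

Definition Phi_Gamma : {rmorphism Phi -> H} :=
  @copair _ _ _ (val : unit_equalizer -> k) val H (etaL H) (etaR H)
    (fun a => eqP (valP a)).

(* Gamma' = k (x)_Phi Gamma                                                   *)
Definition assocRing : comPzRingType := rtensor Phi_mul Phi_Gamma.

Definition assoc_proj : {rmorphism H -> assocRing} :=
  @rinr Phi k H Phi_mul Phi_Gamma.

Definition assoc_etaL : {rmorphism k -> assocRing} := assoc_proj \o etaL H.
Definition assoc_etaR : {rmorphism k -> assocRing} := assoc_proj \o etaR H.

Lemma assoc_etaLE a : assoc_etaL a = a ⊗ 1.
Proof.
have := rinlr Phi_mul Phi_Gamma (rinl a : Phi).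
by rewrite /Phi_mul /Phi_Gamma /rinl /= !copairE /= rmorph1 !mulr1.
Qed.

Lemma assoc_etaRE a : assoc_etaR a = a ⊗ 1.
Proof.
have := rinlr Phi_mul Phi_Gamma (rinr a : Phi).
by rewrite /Phi_mul /Phi_Gamma /rinr /rinl /= !copairE /= rmorph1 !mul1r.
Qed.

Lemma assoc_eta a : assoc_etaL a = assoc_etaR a.
Proof. by rewrite assoc_etaLE assoc_etaRE. Qed.

Lemma assoc_proj_surj z : exists x, z = assoc_proj x.
Proof.
move: z; apply: tens_ind => [|a x _ [y ->]]; first by exists 0; rewrite rmorph0.
exists (etaL H a * x + y); rewrite rmorphD rmorphM; congr (_ + _).
rewrite -[assoc_proj (etaL H a)]/(assoc_etaL a) assoc_etaLE.
exact: rtens_split.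
Qed.

(* epsilon' : a (x) x |-> a * epsilon x                                       *)
Fact assoc_counit_subproof (p : Phi) : idfun (Phi_mul p) = counit H (Phi_Gamma p).
Proof.
move: p; apply: tens_ext => [s t|s t|a b]; rewrite ?rmorphD //.
by rewrite /Phi_mul /Phi_Gamma /= !copairE rmorphM counit_etaL counit_etaR.
Qed.

Definition assoc_counit : {rmorphism assocRing -> k} :=
  copair assoc_counit_subproof.

Lemma assoc_counitE x : assoc_counit (assoc_proj x) = counit H x.
Proof. by rewrite /assoc_counit /= copairE mul1r. Qed.

Fact assoc_proj2_subproof a :
  ((rinl : assocRing -> rtensor assoc_etaR assoc_etaL) \o assoc_proj) (etaR H a)
  = ((rinr : assocRing -> rtensor assoc_etaR assoc_etaL) \o assoc_proj) (etaL H a).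
Proof. exact: (rinlr assoc_etaR assoc_etaL). Qed.

Definition assoc_proj2 :
    {rmorphism rtensor (etaR H) (etaL H) -> rtensor assoc_etaR assoc_etaL} :=
  copair assoc_proj2_subproof.

Lemma assoc_proj2E x y : assoc_proj2 (x ⊗ y) = assoc_proj x ⊗ assoc_proj y.
Proof. by rewrite /assoc_proj2 /= copairE -rtens_split. Qed.

(* psi' : a (x) x |-> (etaL' a (x) 1) * image of psi x                        *)
Fact assoc_coprod_subproof (p : Phi) :
  ((rinl : assocRing -> rtensor assoc_etaR assoc_etaL) \o assoc_etaL) (Phi_mul p)
  = (assoc_proj2 \o coprod H) (Phi_Gamma p).
Proof.
move: p; apply: tens_ext => [s t|s t|a b]; rewrite ?rmorphD //.
rewrite /Phi_mul /Phi_Gamma /= !copairE [idfun _ * idfun _]/(a * b).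
rewrite !rmorphM coprod_etaL coprod_etaR !assoc_proj2E !rmorph1; congr (_ * _).
transitivity (rinl (assoc_etaR b) : rtensor assoc_etaR assoc_etaL).
  by rewrite -assoc_eta.
by rewrite rinlr assoc_eta.
Qed.

Definition assoc_coprod :
    {rmorphism assocRing -> rtensor assoc_etaR assoc_etaL} :=
  copair assoc_coprod_subproof.

Lemma assoc_coprodE x : assoc_coprod (assoc_proj x) = assoc_proj2 (coprod H x).
Proof.
by rewrite /assoc_coprod /= copairE rmorph1 mul1r.
Qed.

(* chi' : a (x) x |-> etaL' a * image of chi x                                *)
Fact assoc_antipode_subproof (p : Phi) :
  assoc_etaL (Phi_mul p) = (assoc_proj \o antipode H) (Phi_Gamma p).
Proof.
move: p; apply: tens_ext => [s t|s t|a b]; rewrite ?rmorphD //.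
rewrite /Phi_mul /Phi_Gamma /= !copairE [idfun _ * idfun _]/(a * b).
rewrite !rmorphM antipode_etaL antipode_etaR; congr (_ * _).
exact: assoc_eta.
Qed.

Definition assoc_antipode : {rmorphism assocRing -> assocRing} :=
  copair assoc_antipode_subproof.

Lemma assoc_antipodeE x :
  assoc_antipode (assoc_proj x) = assoc_proj (antipode H x).
Proof. by rewrite /assoc_antipode /= copairE rmorph1 mul1r. Qed.

Lemma tlift_proj2 (A : zmodType) (h : assocRing -> assocRing -> A)
    (g : H -> H -> A) t :
    balanced (fun (a : k) x => x * assoc_etaR a) (fun (a : k) y => assoc_etaL a * y) h ->
    (forall x y, h (assoc_proj x) (assoc_proj y) = g x y) ->
  tlift h (assoc_proj2 t) = tlift g t.
Proof.
move=> hB hg.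
have gB : balanced (fun (a : k) x => x * etaR H a) (fun (a : k) y => etaL H a * y) g.
  split=> [x x' y|x y y'|a x y]; rewrite -!hg.
  - by rewrite rmorphD (balDl hB).
  - by rewrite rmorphD (balDr hB).
  - by rewrite !rmorphM (bal_act hB).
move: t; apply: tens_ext => [s t|s t|x y].
- by rewrite rmorphD (tliftD hB).
- by rewrite (tliftD gB).
- by rewrite assoc_proj2E (tliftE hB) (tliftE gB).
Qed.

Fact assoc_counit_etaL a : assoc_counit (assoc_etaL a) = a.
Proof. by rewrite assoc_counitE counit_etaL. Qed.

Fact assoc_counit_etaR a : assoc_counit (assoc_etaR a) = a.
Proof. by rewrite assoc_counitE counit_etaR. Qed.

Fact assoc_coprod_etaL a : assoc_coprod (assoc_etaL a) = assoc_etaL a ⊗ 1.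
Proof. by rewrite assoc_coprodE coprod_etaL assoc_proj2E rmorph1. Qed.

Fact assoc_coprod_etaR a : assoc_coprod (assoc_etaR a) = 1 ⊗ assoc_etaR a.
Proof. by rewrite assoc_coprodE coprod_etaR assoc_proj2E rmorph1. Qed.

Fact assoc_antipode_etaL a : assoc_antipode (assoc_etaL a) = assoc_etaR a.
Proof. by rewrite assoc_antipodeE antipode_etaL. Qed.

Fact assoc_antipode_etaR a : assoc_antipode (assoc_etaR a) = assoc_etaL a.
Proof. by rewrite assoc_antipodeE antipode_etaR. Qed.

Local Notation bal' := (balanced (fun (a : k) (x : assocRing) => x * assoc_etaR a)
  (fun (a : k) (y : assocRing) => assoc_etaL a * y)).

Fact assoc_counit_coprodl z :
  tlift (fun x y => assoc_etaL (assoc_counit x) * y) (assoc_coprod z) = z.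
Proof.
have [x ->] := assoc_proj_surj z; rewrite assoc_coprodE.
rewrite (@tlift_proj2 _ _
  (fun x y => assoc_proj (etaL H (counit H x) * y))); last 2 first.
- split=> [x1 x2 y|x1 y y'|a x1 y].
  + by rewrite !rmorphD mulrDl.
  + by rewrite mulrDr.
  + by rewrite !rmorphM assoc_counit_etaR mulrA.
- by move=> x1 y; rewrite assoc_counitE rmorphM.
rewrite -{2}(counit_coprodl x); rewrite /tlift rmorph_sum.
by [].
Qed.

Fact assoc_counit_coprodr z :
  tlift (fun x y => x * assoc_etaR (assoc_counit y)) (assoc_coprod z) = z.
Proof.
have [x ->] := assoc_proj_surj z; rewrite assoc_coprodE.
rewrite (@tlift_proj2 _ _
  (fun x y => assoc_proj (x * etaR H (counit H y)))); last 2 first.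
- split=> [x1 x2 y|x1 y y'|a x1 y].
  + by rewrite mulrDl.
  + by rewrite !rmorphD mulrDr.
  + by rewrite !rmorphM assoc_counit_etaL mulrA.
- by move=> x1 y; rewrite assoc_counitE rmorphM.
rewrite -{2}(counit_coprodr x); rewrite /tlift rmorph_sum.
by [].
Qed.

Fact assoc_antipodel z :
  tlift (fun x y => assoc_antipode x * y) (assoc_coprod z)
  = assoc_etaR (assoc_counit z).
Proof.
have [x ->] := assoc_proj_surj z; rewrite assoc_coprodE assoc_counitE.
rewrite (@tlift_proj2 _ _
  (fun x y => assoc_proj (antipode H x * y))); last 2 first.
- split=> [x1 x2 y|x1 y y'|a x1 y].
  + by rewrite rmorphD mulrDl.
  + by rewrite mulrDr.
  + by rewrite rmorphM assoc_antipode_etaR mulrA.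
- by move=> x1 y; rewrite assoc_antipodeE rmorphM.
rewrite -[RHS]/(assoc_proj (etaR H (counit H x))) -antipodel.
by rewrite /tlift rmorph_sum.
Qed.

Fact assoc_antipoder z :
  tlift (fun x y => x * assoc_antipode y) (assoc_coprod z)
  = assoc_etaL (assoc_counit z).
Proof.
have [x ->] := assoc_proj_surj z; rewrite assoc_coprodE assoc_counitE.
rewrite (@tlift_proj2 _ _
  (fun x y => assoc_proj (x * antipode H y))); last 2 first.
- split=> [x1 x2 y|x1 y y'|a x1 y].
  + by rewrite mulrDl.
  + by rewrite rmorphD mulrDr.
  + by rewrite rmorphM assoc_antipode_etaL mulrA.
- by move=> x1 y; rewrite assoc_antipodeE rmorphM.
rewrite -[RHS]/(assoc_proj (etaL H (counit H x))) -antipoder.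
by rewrite /tlift rmorph_sum.
Qed.

Local Notation G2 := (rtensor (etaR H) (etaL H)).
Local Notation G3 := (rtensor (etaR H) (fun a => etaL H a ⊗ 1 : G2)).
Local Notation G2' := (rtensor assoc_etaR assoc_etaL).
Local Notation G3' := (rtensor assoc_etaR (fun a => assoc_etaL a ⊗ 1 : G2')).

Fact assoc_proj3_subproof a :
  ((rinl : assocRing -> G3') \o assoc_proj) (etaR H a)
  = ((rinr : G2' -> G3') \o assoc_proj2) (etaL H a ⊗ 1).
Proof.
rewrite /= assoc_proj2E rmorph1.
exact: (rinlr assoc_etaR (fun a => assoc_etaL a ⊗ 1 : G2')).
Qed.

Definition assoc_proj3 : {rmorphism G3 -> G3'} := copair assoc_proj3_subproof.

Lemma assoc_proj3E x t : assoc_proj3 (x ⊗ t) = assoc_proj x ⊗ assoc_proj2 t.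
Proof. by rewrite /assoc_proj3 /= copairE -rtens_split. Qed.

Lemma assoc_insert_bal (y : assocRing) :
  bal' (fun x1 x2 => x1 ⊗ (x2 ⊗ y : G2') : G3').
Proof.
split=> [x x' x2|x x2 x2'|a x x2].
- by rewrite tens_pureDl.
- by rewrite tens_pureDl tens_pureDr.
- rewrite tens_pure_bal; congr (_ ⊗ _).
  by rewrite rtensM mul1r.
Qed.

Lemma assoc_coprod_insert_bal :
  bal' (fun x y => tlift (fun x1 x2 => x1 ⊗ (x2 ⊗ y : G2') : G3')
    (assoc_coprod x)).
Proof.
split=> [x x' y|x y y'|a x y].
- by rewrite rmorphD (tliftD (assoc_insert_bal y)).
- move: (assoc_coprod x); apply: tens_ext => [s t|s t|x1 x2].
  + exact: tliftD (assoc_insert_bal _) s t.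
  + by rewrite !(tliftD (assoc_insert_bal _)) addrACA.
  + by rewrite !(tliftE (assoc_insert_bal _)) !tens_pureDr.
- rewrite rmorphM assoc_coprod_etaR.
  move: (assoc_coprod x); apply: tens_ext => [s t|s t|x1 x2].
  + by rewrite mulrDl (tliftD (assoc_insert_bal _)).
  + exact: tliftD (assoc_insert_bal _) s t.
  + rewrite rtensM mulr1 !(tliftE (assoc_insert_bal _)).
    by rewrite tens_pure_bal.
Qed.

Fact assoc_coprodA z :
  tlift (fun x y => tlift (fun x1 x2 => x1 ⊗ (x2 ⊗ y : G2') : G3')
    (assoc_coprod x)) (assoc_coprod z)
  = tlift (fun x y => x ⊗ assoc_coprod y : G3') (assoc_coprod z).
Proof.
have [x ->] := assoc_proj_surj z; rewrite assoc_coprodE.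
rewrite (@tlift_proj2 _ _ (fun x y => assoc_proj3
  (tlift (fun x1 x2 => x1 ⊗ (x2 ⊗ y : G2) : G3) (coprod H x)))); last 2 first.
- exact: assoc_coprod_insert_bal.
- move=> x1 y; rewrite assoc_coprodE.
  rewrite (@tlift_proj2 _ _
    (fun x1 x2 => assoc_proj3 (x1 ⊗ (x2 ⊗ y : G2) : G3))).
  + by rewrite /tlift rmorph_sum.
  + exact: assoc_insert_bal.
  + by move=> x2 x3; rewrite assoc_proj3E assoc_proj2E.
rewrite (@tlift_proj2 _ _
  (fun x y => assoc_proj3 (x ⊗ coprod H y : G3))); last 2 first.
- split=> [x1 x2 y|x1 y y'|a x1 y].
  + by rewrite tens_pureDl.
  + by rewrite rmorphD tens_pureDr.
  + by rewrite tens_pure_bal rmorphM assoc_coprod_etaL.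
- by move=> x1 y; rewrite assoc_proj3E assoc_coprodE.
have := congr1 assoc_proj3 (coprodA x).
by rewrite /tlift !rmorph_sum.
Qed.

(* (k, Gamma'); it is a Hopf algebra by [assoc_eta].                          *)
Definition assocHopf : hopfAlgebroid k := HopfAlgebroid
  assoc_counit_etaL assoc_counit_etaR assoc_coprod_etaL assoc_coprod_etaR
  assoc_counit_coprodl assoc_counit_coprodr assoc_coprodA
  assoc_antipode_etaL assoc_antipode_etaR assoc_antipodel assoc_antipoder.

End Associated.

(* Main.v *)
(* A comodule of dimension n is a matrix g over Gamma with psi g = g (x) g and
   epsilon g = 1, a primitive is a row a over k with etaL(a) g = etaR(a), and one
   may assume g irreducible. A primitive a of the induced Gamma'-comodule gives,
   for a column f with a f = 1 and t = g etaR(f), an element etaL(a) t of Gamma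
   congruent to 1 modulo the ideal I generated by the etaL b - etaR b. The entries
   of t span a subbimodule C of Gamma, stable under all slices of psi by right
   k-linear functionals. As 1 lies in C + I, a determinant argument shows that C
   contains an element of the image of k (x) k of counit 1; a shortest nonzero
   element of C of that form is, up to a scalar, etaR(b), so C contains 1. Write
   1 = sum_i etaL(w_i) t etaR(b_i) with as few terms as possible: by irreducibility
   the comodule map (v_i) |-> sum_i etaL(v_i) t etaR(b_i) is injective, so the w_i
   are primitive because 1 is. *)
Require Import Defs.
From mathcomp Require Import all_boot all_algebra.
From HB Require Import structures.
From mathcomp Require Import boolp classical_sets.

Set Implicit Arguments.
Unset Strict Implicit.
Unset Printing Implicit Defensive.

Import GRing.Theory.
Local Open Scope ring_scope.

(** * Linear algebra over the field k *)

Section LinearAlgebra.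
Variable k : fieldType.

Local Open Scope classical_set_scope.

(** Zorn's lemma yields a subspace [A] maximal among those omitting v. Every vector is congruent
    modulo [A] to a unique multiple of v, and f reads off the coefficient. *)
Lemma functional_separation (V : lmodType k) (v : V) :
  v != 0 -> exists f : {linear V -> k^o}, f v != 0.
Proof.
move=> v0.
pose P (A : set V) :=
  (forall a x y, A x -> A y -> A (a *: x + y)) /\ ~ A v.
have [F sFP totF|A [[Alin Av] Amax]] := @Zorn_bigcup V P.
  split=> [a x y [X FX Xx] [Y FY Yy]|[X FX Xv]]; last by have [] := sFP X FX.
  have [XY|YX] := totF X Y FX FY.
    by exists Y => //; have [+ _] := sFP Y FY; apply=> //; apply: XY.
  by exists X => //; have [+ _] := sFP X FX; apply=> //; apply: YX.
(* [P] also holds of the empty set, the union of the empty chain, so 0 in [A] has to come from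
   maximality, by comparison with {0}. *)
have A0 : A 0.
  have [[x Ax]|A_0] := pselect (exists x, A x).
    by rewrite -(addNr x) -scaleN1r; apply: Alin.
  have []:= Amax [set 0].
    by split=> [y Ay|/(_ 0 erefl) A00]; case: A_0; [exists y | exists 0].
  by split=> [a x y -> ->|/= ve]; [rewrite scaler0 addr0 | case/eqP: v0].
have scaleA a x : A x -> A (a *: x).
  by move=> Ax; rewrite -[_ *: _]addr0; apply: Alin.
have AD x y : A x -> A y -> A (x + y).
  by move=> Ax Ay; rewrite -[x]scale1r; apply: Alin.
have dec w : exists c : k, A (w - c *: v).
  have [Aw|Aw] := pselect (A w); first by exists 0; rewrite scale0r subr0.
  have [|nB] := pselect (exists c, A (v - c *: w)).
    case=> c Ac; have c0 : c != 0.
      by apply: contra_notN Av => /eqP c0; rewrite c0 scale0r subr0 in Ac.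
    exists c^-1; rewrite -opprB -scaleN1r; apply: (scaleA).
    have -> : c^-1 *: v - w = c^-1 *: (v - c *: w).
      by rewrite scalerBr scalerA mulVf // scale1r.
    exact: scaleA.
  (* This set is A + k w. It strictly contains [A] and omits v by [nB], against maximality. *)
  have [] := Amax [set y | exists c, A (y - c *: w)].
    split=> [y Ay|]; first by exists 0; rewrite scale0r subr0.
    by move/(_ w); apply: contra_not Aw; apply; exists 1; rewrite scale1r subrr.
  split=> // a x y [c Ac] [d Ad]; exists (a * c + d).
  have -> : a *: x + y - (a * c + d) *: w = a *: (x - c *: w) + (y - d *: w).
    by rewrite scalerBr scalerA scalerDl opprD addrACA.
  exact: Alin.
have uniq w c d : A (w - c *: v) -> A (w - d *: v) -> c = d.
  move=> Ac Ad; apply/eqP; rewrite -subr_eq0; apply: contra_notT Av => cd.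
  have : A ((d - c)^-1 *: (-1 *: (w - d *: v) + (w - c *: v))).
    by apply: scaleA; apply: Alin.
  rewrite scaleN1r opprB addrA subrK -scalerBl scalerA mulVf ?scale1r //.
  by rewrite -opprB oppr_eq0.
pose f w : k^o := xget 0 [set c | A (w - c *: v)].
have fP w : A (w - f w *: v).
  by have [c Ac] := dec w; apply: (xgetPex 0 (P := [set c | A (w - c *: v)])); exists c.
have f_lin : linear f.
  move=> a x y; apply: uniq (fP _) _.
  rewrite scalerDl opprD addrACA -scalerA -scalerBr; exact: Alin.
pose fM := GRing.isLinear.Build _ _ _ _ f f_lin.
pose F : {linear V -> k^o} := HB.pack f fM.
exists F; apply: contra_notN Av => /eqP fv.
by have := fP v; rewrite [f v]fv scale0r subr0.
Qed.

Local Close Scope classical_set_scope.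

(** Turns a subspace given as a predicate into a row space. The rows of [B] are an independent
    family in [P] of maximal size, which exists because such a family has at most n members. *)
Lemma subspace_row_base n (P : 'rV[k]_n -> Prop) :
    P 0 -> (forall a u v, P u -> P v -> P (a *: u + v)) ->
  exists r (B : 'M_(r, n)), row_free B /\ forall v, P v <-> (v <= B)%MS.
Proof.
move=> P0 PD.
have closed r (B : 'M_(r, n)) : (forall i, P (row i B)) -> forall v, (v <= B)%MS -> P v.
  move=> PB v /submxP[c ->]; rewrite mulmx_sum_row.
  elim/big_ind: _ => // [u w Pu Pw|i _].
    by rewrite -[u]scale1r; apply: PD.
  by rewrite -[_ *: _]addr0; apply: PD.
pose Q r := `[< exists B : 'M_(r, n), row_free B /\ forall i, P (row i B) >].
have Q0 : exists r, Q r.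
  exists 0; apply/asboolP; exists (0 : 'M_(0, n)); split=> [|[]//].
  by rewrite /row_free mxrank0.
have Qn r : Q r -> (r <= n)%N.
  move=> /asboolP[B [+ _]]; rewrite -row_leq_rank => /leq_trans; apply.
  exact: rank_leq_col.
have [r /asboolP[B [Bfree PB]] rmax] := ex_maxnP Q0 Qn.
exists r, B; split=> // v; split=> [Pv|]; last exact: closed.
apply: contraT => vB; suff /rmax : Q (r + 1)%N by rewrite addn1 ltnn.
apply/asboolP; exists (col_mx B v); split.
  have /rank_ltmx : (B < B + v)%MS.
    by rewrite ltmxE addsmxSl addsmx_sub submx_refl /= (negbTE vB).
  by rewrite addsmxE (eqP Bfree) -row_leq_rank -[X in (X <= _)%N -> _]addn1.
move=> i; case: (split_ordP i) => j ->.
  by rewrite rowKu.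
by rewrite rowKd row_id.
Qed.

End LinearAlgebra.

(** * Right linear functionals on Gamma and slices of the coproduct *)

Section Slices.
Variables (k : fieldType) (H : hopfAlgebroid k).

Local Notation G2 := (rtensor (etaR H) (etaL H)).
Local Notation "A ^L" := (map_mx (etaL H) A) (at level 2, format "A ^L").
Local Notation "A ^R" := (map_mx (etaR H) A) (at level 2, format "A ^R").

(** Linearity refers to [etaR], the structure balanced on the left factor of Gamma (x)_k Gamma, so a
    functional can be applied to that factor. *)
Record functional := Functional {
  functional_fun :> H -> k;
  functional_additive : zmod_morphism functional_fun;
  functionalR : forall y a, functional_fun (y * etaR H a) = functional_fun y * a
}.

HB.instance Definition _ (lam : functional) :=
  GRing.isZmodMorphism.Build H k lam (functional_additive lam).

(** A copy of Gamma that carries the k-vector space structure through [etaR], to which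
    [functional_separation] applies. *)
Definition right_module : Type := H.
HB.instance Definition _ := GRing.Zmodule.on right_module.

Definition right_scale (a : k) (x : right_module) : right_module :=
  (x : H) * etaR H a.

Fact right_scaleA a b x : right_scale a (right_scale b x) = right_scale (a * b) x.
Proof. by rewrite /right_scale -mulrA -rmorphM mulrC [b * a]mulrC mulrC. Qed.

Fact right_scale1 : left_id 1 right_scale.
Proof. by move=> x; rewrite /right_scale rmorph1 mulr1. Qed.

Fact right_scaleDr : right_distributive right_scale +%R.
Proof. by move=> a x y; rewrite /right_scale mulrDl. Qed.

Fact right_scaleDl x : {morph right_scale^~ x : a b / a + b}.
Proof. by move=> a b; rewrite /right_scale rmorphD mulrDr. Qed.

HB.instance Definition _ := GRing.Zmodule_isLmodule.Build k right_module
  right_scaleA right_scale1 right_scaleDr right_scaleDl.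

Lemma functionals_separate (x : H) : (forall lam : functional, lam x = 0) -> x = 0.
Proof.
move=> lx; apply/eqP/negPn/negP => x0.
have [f] := @functional_separation k right_module x x0.
have fB : zmod_morphism (f : H -> k) by move=> y z; apply: raddfB.
have fR y a : (f : H -> k) (y * etaR H a) = f y * a.
  by rewrite [RHS]mulrC; exact (linearZZ f a y).
by rewrite -[f x]/(Functional fB fR x) lx eqxx.
Qed.

Lemma functional_linear_comb a (f g : functional) :
  exists h : functional, forall x, h x = a * f x + g x.
Proof.
pose h x := a * f x + g x.
have hB : zmod_morphism h.
  by move=> x y; rewrite /h !raddfB /= mulrBr opprD addrACA.
have hR y b : h (y * etaR H b) = h y * b.
  by rewrite /h !functionalR mulrA mulrDl.
by exists (Functional hB hR).
Qed.

Lemma functional_zero : exists h : functional, forall x, h x = 0.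
Proof.
have hB : zmod_morphism (fun _ : H => 0 : k) by move=> x y; rewrite subr0.
have hR y b : (fun _ : H => 0 : k) (y * etaR H b) = 0 * b by rewrite mul0r.
by exists (Functional hB hR).
Qed.

Lemma functional_mulmxR (lam : functional) p q r (A : 'M[H]_(p, q)) (C : 'M[k]_(q, r)) :
  map_mx lam (A *m C^R) = map_mx lam A *m C.
Proof.
apply/matrixP=> i j; rewrite !mxE raddf_sum; apply: eq_bigr => l _.
by rewrite !mxE /= functionalR.
Qed.

Lemma functionals_separate_mx p q (A : 'M[H]_(p, q)) :
  (forall lam : functional, map_mx lam A = 0) -> A = 0.
Proof.
move=> lA; apply/matrixP=> i j; rewrite mxE; apply: functionals_separate => lam.
by have /matrixP/(_ i j) := lA lam; rewrite !mxE.
Qed.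

(* If B C = 1 then C B is a projector fixing the row space of B, so           *)
(* y - y R(C B) is annihilated by all functionals.                            *)
Lemma functional_row_factor n r (y : 'rV[H]_n) (B : 'M[k]_(r, n)) (C : 'M[k]_(n, r)) :
    B *m C = 1%:M -> (forall lam : functional, (map_mx lam y <= B)%MS) ->
  y = y *m C^R *m B^R.
Proof.
move=> BC yB; apply/subr0_eq/functionals_separate_mx => lam.
rewrite map_mxB -mulmxA -map_mxM functional_mulmxR.
have /submxP[c ->] := yB lam.
by rewrite mulmxA -(mulmxA c) BC mulmx1 subrr.
Qed.

(** The entries are the sums over l of A_il (x) B_lj. As an ordinary product over the ring Gamma
    (x)_k Gamma, it inherits the algebra of matrix products. *)
Definition tmx p q r (A : 'M[H]_(p, q)) (B : 'M[H]_(q, r)) : 'M[G2]_(p, r) :=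
  map_mx rinl A *m map_mx rinr B.

Lemma tmx_bal p q q' r (A : 'M[H]_(p, q)) (C : 'M[k]_(q, q')) (B : 'M[H]_(q', r)) :
  tmx (A *m C^R) B = tmx A (C^L *m B).
Proof.
rewrite /tmx !map_mxM mulmxA; congr (_ *m _ *m _).
by apply/matrixP=> i j; rewrite !mxE; apply: rinlr.
Qed.

Lemma tmxBl p q r (A A' : 'M[H]_(p, q)) (B : 'M[H]_(q, r)) :
  tmx (A - A') B = tmx A B - tmx A' B.
Proof. by rewrite /tmx map_mxB mulmxBl. Qed.

Lemma tmx_repr (t : G2) : exists r (x : 'rV[H]_r) (y : 'cV[H]_r), t%:M = tmx x y.
Proof.
move: t; apply: tens_ind => [|x y t [r [u [v tE]]]].
  exists 0, 0, 0; rewrite /tmx map_mx0 mul0mx.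
  by apply/matrixP=> i j; rewrite !mxE mul0rn.
exists (1 + r)%N, (row_mx x%:M u), (col_mx y%:M v).
rewrite /tmx map_row_mx map_col_mx mul_row_col raddfD /= tE.
by rewrite !map_scalar_mx -scalar_mxM -rtens_split.
Qed.

(** A representation of least length works. If t = x M (x) y for a matrix M over k, a rank
    factorization of M gives one of length rank M, so M is invertible. A dependence f or c would
    allow the singular M = 1 - f d with d f = 1, or M = 1 - d c with c d = 1. *)
Lemma tmx_minimal_repr (t : G2) : exists r (x : 'rV[H]_r) (y : 'cV[H]_r),
  [/\ t%:M = tmx x y, forall f : 'cV[k]_r, x *m f^R = 0 -> f = 0
    & forall c : 'rV[k]_r, c^L *m y = 0 -> c = 0].
Proof.
pose Q r := `[< exists (x : 'rV[H]_r) (y : 'cV[H]_r), t%:M = tmx x y >].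
have Qex : exists r, Q r.
  by have [r xy] := tmx_repr t; exists r; apply/asboolP.
have [r /asboolP[x [y txy]] rmin] := ex_minnP Qex.
have full (M : 'M_r) : t%:M = tmx (x *m M^R) y -> row_free M.
  move=> tM; rewrite -row_leq_rank; apply: rmin; apply/asboolP.
  exists (x *m (col_base M)^R), ((row_base M)^L *m y).
  by rewrite -tmx_bal -mulmxA -map_mxM mulmx_base.
exists r, x, y; split=> // [f xf|c cy]; apply/eqP/negPn/negP => nz.
  have [d df] : exists d : 'rV_r, d *m f = 1%:M.
    have : row_free f^T.
      rewrite /row_free mxrank_tr; rewrite -mxrank_eq0 in nz.
      by rewrite eqn_leq lt0n nz rank_leq_col.
    by case/row_freeP=> d /(congr1 trmx); rewrite trmx_mul trmxK trmx1 => ?; exists d^T.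
  have /full/row_free_inj Minj : t%:M = tmx (x *m (1%:M - f *m d)^R) y.
    by rewrite map_mxB map_mxM map_mx1 mulmxBr mulmx1 mulmxA xf mul0mx subr0.
  suff d0 : d = 0.
    move: df; rewrite d0 mul0mx => /matrixP/(_ 0 0)/eqP.
    by rewrite !mxE eq_sym oner_eq0.
  by apply: Minj; rewrite mul0mx mulmxBr mulmx1 mulmxA df mul1mx subrr.
have [d df] : exists d : 'cV_r, c *m d = 1%:M.
  apply/row_freeP; rewrite /row_free; rewrite -mxrank_eq0 in nz.
  by rewrite eqn_leq lt0n nz rank_leq_row.
have /full/row_free_inj Minj : t%:M = tmx (x *m (1%:M - d *m c)^R) y.
  by rewrite tmx_bal map_mxB map_mxM map_mx1 mulmxBl mul1mx -mulmxA cy mulmx0 subr0.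
case/eqP: nz; apply: Minj.
by rewrite mul0mx mulmxBr mulmx1 mulmxA df mul1mx subrr.
Qed.

(** The values of all functionals on x form a subspace of row vectors. Were it proper, a nonzero
    column f of its cokernel matrix would satisfy lam (x f) = 0 for every lam, hence x f = 0. *)
Lemma dual_functionals r (x : 'rV[H]_r) :
    (forall f : 'cV[k]_r, x *m f^R = 0 -> f = 0) ->
  exists lam : 'I_r -> functional, forall i, map_mx (lam i) x = delta_mx 0 i.
Proof.
move=> xfree; pose P v := exists lam : functional, map_mx lam x = v.
have P0 : P 0.
  have [h h0] := functional_zero; exists h.
  by apply/matrixP=> i j; rewrite !mxE h0.
have PD a u v : P u -> P v -> P (a *: u + v).
  move=> [f <-] [g <-]; have [h hE] := functional_linear_comb a f g.
  by exists h; apply/matrixP=> i j; rewrite !mxE hE.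
have [s [B [_ PB]]] := subspace_row_base P0 PD.
have B1 : (1%:M <= B)%MS.
  rewrite submxE mul1mx; apply/eqP/matrixP=> i j; rewrite [RHS]mxE.
  have -> : cokermx B i j = col j (cokermx B) i 0 by rewrite [RHS]mxE.
  rewrite (xfree (col j (cokermx B))) ?[LHS]mxE //; apply: functionals_separate_mx => lam.
  rewrite functional_mulmxR; have /PB/submxP[c ->] : P (map_mx lam x) by exists lam.
  by rewrite colE -mulmxA (mulmxA B) mulmx_coker mul0mx mulmx0.
have Pd i : exists lam : functional, map_mx lam x = delta_mx 0 i.
  by apply/PB; apply: submx_trans B1; apply: submx1.
by have [lam lamP] := choice Pd; exists lam.
Qed.

Section Slice.
Variable lam : functional.

(** This is lam (x) id, with k (x)_k Gamma identified with Gamma. *)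
Definition slice : G2 -> H := tlift (fun x y => etaL H (lam x) * y).

Fact slice_bal : balanced (fun (a : k) (x : H) => x * etaR H a)
  (fun (a : k) (y : H) => etaL H a * y) (fun x y => etaL H (lam x) * y).
Proof.
split=> [x x' y|x y y'|a x y].
- by rewrite !raddfD mulrDl.
- by rewrite mulrDr.
- by rewrite functionalR rmorphM mulrA.
Qed.

Fact slice_is_additive : zmod_morphism slice.
Proof.
by move=> s t; apply: (addIr (slice t)); rewrite -(tliftD slice_bal) !subrK.
Qed.

HB.instance Definition _ := GRing.isZmodMorphism.Build G2 H slice slice_is_additive.

Lemma sliceE x y : slice (rinl x * rinr y) = etaL H (lam x) * y.
Proof. by rewrite -rtens_split; apply: tliftE slice_bal x y. Qed.

Lemma sliceMr t y : slice (t * rinr y) = slice t * y.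
Proof.
move: t; apply: tens_ext => [s t|s t|x z]; rewrite ?mulrDl ?raddfD /= ?mulrDl //.
by rewrite rtens_split -mulrA -rmorphM !sliceE mulrA.
Qed.

Lemma slice_tmx p q r (A : 'M[H]_(p, q)) (B : 'M[H]_(q, r)) :
  map_mx slice (tmx A B) = (map_mx lam A)^L *m B.
Proof.
apply/matrixP=> i j; rewrite !mxE raddf_sum; apply: eq_bigr => l _.
by rewrite !mxE /= sliceE.
Qed.

(** The operator (lam (x) id) psi. Stability under all these operators replaces the notion of a left
    subcomodule of Gamma. *)
Definition act (n : H) : H := slice (coprod H n).

Fact act_is_additive : zmod_morphism act.
Proof. by move=> x y; rewrite /act !raddfB. Qed.
HB.instance Definition _ := GRing.isZmodMorphism.Build H H act act_is_additive.

Lemma actR n a : act (n * etaR H a) = act n * etaR H a.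
Proof. by rewrite /act rmorphM coprod_etaR sliceMr. Qed.

Lemma counit_act n : counit H (act n) = lam n.
Proof.
rewrite -[in RHS](counit_coprodr n) /act /slice /tlift !raddf_sum /=.
by apply: eq_bigr => p _; rewrite rmorphM counit_etaL functionalR.
Qed.

(** This is [act] (x) id; it is well defined by [actR]. *)
Definition act2 : G2 -> G2 := tlift (fun x y => rinl (act x) * rinr y : G2).

Fact act2_bal : balanced (fun (a : k) (x : H) => x * etaR H a)
  (fun (a : k) (y : H) => etaL H a * y) (fun x y => rinl (act x) * rinr y : G2).
Proof.
split=> [x x' y|x y y'|a x y].
- by rewrite !raddfD mulrDl.
- by rewrite raddfD mulrDr.
- by rewrite actR rmorphM /= rinlr rmorphM mulrA.
Qed.

Lemma act2E x y : act2 (rinl x * rinr y) = rinl (act x) * rinr y.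
Proof. by rewrite -rtens_split; apply: tliftE act2_bal x y. Qed.

Fact act2_is_additive : zmod_morphism act2.
Proof.
by move=> s t; apply: (addIr (act2 t)); rewrite -(tliftD act2_bal) !subrK.
Qed.
HB.instance Definition _ := GRing.isZmodMorphism.Build G2 G2 act2 act2_is_additive.

Lemma act2_tmx p q r (A : 'M[H]_(p, q)) (B : 'M[H]_(q, r)) :
  map_mx act2 (tmx A B) = tmx (map_mx act A) B.
Proof.
apply/matrixP=> i j; rewrite !mxE raddf_sum; apply: eq_bigr => l _.
by rewrite !mxE /= act2E.
Qed.

Local Notation G3 := (rtensor (etaR H) (fun a => etaL H a ⊗ 1 : G2)).

(** Both sides arise by applying lam (x) id (x) id, the map [s3], to the two sides of
    coassociativity. *)
Lemma coprod_act n : coprod H (act n) = act2 (coprod H n).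
Proof.
pose s3 : G3 -> G2 := tlift (fun x t => rinl (etaL H (lam x)) * t).
have s3B : balanced (fun (a : k) (x : H) => x * etaR H a)
    (fun (a : k) (t : G2) => (etaL H a ⊗ 1 : G2) * t)
    (fun x t => rinl (etaL H (lam x)) * t : G2).
  split=> [x x' y|x y y'|a x y].
  - by rewrite !raddfD mulrDl.
  - by rewrite mulrDr.
  - by rewrite functionalR rmorphM rmorphM -mulrA.
have s3A : zmod_morphism s3.
  by move=> s t; apply: (addIr (s3 t)); rewrite -(tliftD s3B) !subrK.
pose s3M := GRing.isZmodMorphism.Build G3 G2 s3 s3A.
pose S3 : {additive G3 -> G2} := HB.pack s3 s3M.
have s3E x t : S3 (x ⊗ t) = rinl (etaL H (lam x)) * t by apply: tliftE s3B x t.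
transitivity (S3 (tlift (fun x y => x ⊗ coprod H y : G3) (coprod H n))).
  rewrite /act /slice /tlift !raddf_sum; apply: eq_bigr => p _.
  by rewrite s3E [LHS]rmorphM [X in X * _]coprod_etaL.
rewrite -coprodA /act2 /tlift !raddf_sum; apply: eq_bigr => p _.
rewrite /act /slice /tlift !raddf_sum mulr_suml; apply: eq_bigr => q _.
by rewrite s3E [in LHS]rtens_split mulrA -rmorphM.
Qed.

End Slice.
End Slices.

(** * Grouplike matrices and local finiteness of Gamma *)

Section Grouplike.
Variables (k : fieldType) (H : hopfAlgebroid k).

Local Notation G2 := (rtensor (etaR H) (etaL H)).
Local Notation "A ^L" := (map_mx (etaL H) A) (at level 2, format "A ^L").
Local Notation "A ^R" := (map_mx (etaR H) A) (at level 2, format "A ^R").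

(** In a shortest representation of t, functionals dual to the left factors return the right factors
    as slices of t. *)
Lemma slices_separate (t : G2) : (forall lam : functional H, slice lam t = 0) -> t = 0.
Proof.
move=> t0; have [r [x [y [txy xfree _]]]] := tmx_minimal_repr t.
have [lam lamP] := dual_functionals xfree.
have y0 : y = 0.
  apply/row_matrixP=> i; rewrite row0 rowE.
  rewrite -(map_delta_mx (etaL H)) -lamP -slice_tmx -txy.
  by apply/matrixP=> i' j; rewrite !mxE raddfMn /= t0 mul0rn.
have /matrixP/(_ 0 0) : t%:M = 0 :> 'M_1 by rewrite txy y0 /tmx map_mx0 mulmx0.
by rewrite !mxE mulr1n.
Qed.

Lemma slices_separate_mx p q (A B : 'M[G2]_(p, q)) :
  (forall lam : functional H, map_mx (slice lam) A = map_mx (slice lam) B) -> A = B.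
Proof.
move=> AB; apply/matrixP=> i j; apply/subr0_eq/slices_separate => lam.
have /matrixP/(_ i j) := AB lam; rewrite !mxE raddfB /= => ->.
by rewrite subrr.
Qed.

Definition left_free r p (y : 'M[H]_(r, p)) := forall c : 'rV[k]_r, c^L *m y = 0 -> c = 0.

Lemma left_free_mx r p (y : 'M[H]_(r, p)) q (C : 'M[k]_(q, r)) :
  left_free y -> C^L *m y = 0 -> C = 0.
Proof.
move=> yfree Cy; apply/row_matrixP=> i; rewrite row0; apply: yfree.
by rewrite map_row -row_mul Cy row0.
Qed.

Lemma tmx_left_free r p (y : 'M[H]_(r, p)) q (Z : 'M[H]_(q, r)) :
  left_free y -> tmx Z y = 0 -> Z = 0.
Proof.
move=> yfree Zy; apply: functionals_separate_mx => lam.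
by apply: left_free_mx yfree _; rewrite -slice_tmx Zy map_mx0.
Qed.

Lemma counit_functional : exists lam : functional H, lam =1 counit H.
Proof.
have eR y a : counit H (y * etaR H a) = counit H y * a by rewrite rmorphM counit_etaR.
by exists (@Functional k H (counit H) (raddfB _) eR).
Qed.

Lemma coprod_tmx_counit p q r (A : 'M[H]_(p, r)) (X : 'M[H]_(p, q)) (Y : 'M[H]_(q, r)) :
  map_mx (coprod H) A = tmx X Y -> A = (map_mx (counit H) X)^L *m Y.
Proof.
move=> AXY; have [lam lamE] := counit_functional.
have -> : map_mx (counit H) X = map_mx lam X.
  by apply/matrixP=> i j; rewrite !mxE lamE.
rewrite -slice_tmx -AXY; apply/matrixP=> i j; rewrite !mxE.
rewrite -[LHS]counit_coprodl /slice /tlift.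
by apply: eq_bigr => x _; rewrite lamE.
Qed.

Lemma slice_coprod (lam : functional H) p q (A : 'M[H]_(p, q)) :
  map_mx (slice lam) (map_mx (coprod H) A) = map_mx (act lam) A.
Proof. by apply/matrixP=> i j; rewrite !mxE. Qed.

Lemma coprod_act_mx (lam : functional H) p q (A : 'M[H]_(p, q)) :
  map_mx (coprod H) (map_mx (act lam) A) = map_mx (act2 lam) (map_mx (coprod H) A).
Proof. by apply/matrixP=> i j; rewrite !mxE coprod_act. Qed.

Lemma coprod_mulL p q r (C : 'M[k]_(p, q)) (A : 'M[H]_(q, r)) :
  map_mx (coprod H) (C^L *m A) = map_mx rinl C^L *m map_mx (coprod H) A.
Proof.
rewrite map_mxM; congr (_ *m _).
by apply/matrixP=> i j; rewrite !mxE coprod_etaL.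
Qed.

Lemma coprod_mulR p q r (A : 'M[H]_(p, q)) (C : 'M[k]_(q, r)) :
  map_mx (coprod H) (A *m C^R) = map_mx (coprod H) A *m map_mx rinr C^R.
Proof.
rewrite map_mxM; congr (_ *m _).
by apply/matrixP=> i j; rewrite !mxE coprod_etaR.
Qed.

Lemma tmx_mulL p q r s (C : 'M[k]_(p, q)) (A : 'M[H]_(q, r)) (B : 'M[H]_(r, s)) :
  map_mx rinl C^L *m tmx A B = tmx (C^L *m A) B.
Proof. by rewrite /tmx mulmxA -map_mxM. Qed.

Lemma tmx_mulR p q r s (A : 'M[H]_(p, q)) (B : 'M[H]_(q, r)) (C : 'M[k]_(r, s)) :
  tmx A B *m map_mx rinr C^R = tmx A (B *m C^R).
Proof. by rewrite /tmx -mulmxA -map_mxM. Qed.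

(* The matrix of the coaction on a comodule with basis v_1, ..., v_n:         *)
(* rho v_i is the sum of the g_ij (x) v_j.                                    *)
Record grouplike n (g : 'M[H]_n) : Prop := Grouplike {
  grouplike_coprod : map_mx (coprod H) g = tmx g g;
  grouplike_counit : map_mx (counit H) g = 1%:M
}.

(** Left independence of the rows of u lets coassociativity and the counit axiom pass from u to its
    coefficient matrix. Coassociativity enters as [coprod_act_mx] after slicing, so that only two
    tensor factors ever occur. *)
Lemma left_free_grouplike n p (mu : 'M[H]_n) (u : 'M[H]_(n, p)) :
  left_free u -> map_mx (coprod H) u = tmx mu u -> grouplike mu.
Proof.
move=> ufree um; split.
  apply: slices_separate_mx => lam; rewrite slice_coprod slice_tmx.
  apply/subr0_eq/(tmx_left_free ufree); rewrite tmxBl -tmx_mulL -um -coprod_mulL.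
  by rewrite -act2_tmx -um -coprod_act_mx -slice_tmx -um slice_coprod subrr.
apply/subr0_eq/(left_free_mx ufree).
by rewrite map_mxB mulmxBl -(coprod_tmx_counit um) map_mx1 mul1mx subrr.
Qed.

(** Take psi n = sum_j x_j (x) y_j of least length. With [lam] dual to x, each y_i is
    [act (lam i) n], so psi y_i = sum_j act (lam i) x_j (x) y_j by [coprod_act]. The counit axiom
    gives the coefficients of n. *)
Lemma locally_finite (n : H) : exists r (mu : 'M[H]_r) (u : 'cV[H]_r) (d : 'rV[k]_r),
  [/\ grouplike mu, map_mx (coprod H) u = tmx mu u & n%:M = d^L *m u].
Proof.
have [r [x [y [nxy xfree yfree]]]] := tmx_minimal_repr (coprod H n).
have [lam lamP] := dual_functionals xfree.
pose mu : 'M[H]_r := \matrix_(i, j) act (lam i) (x 0 j).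
have ymu : map_mx (coprod H) y = tmx mu y.
  apply/row_matrixP=> i; rewrite -map_row /tmx row_mul -map_row.
  have -> : row i mu = map_mx (act (lam i)) x.
    by apply/matrixP=> a b; rewrite !mxE ord1.
  have -> : row i y = map_mx (act (lam i)) n%:M.
    rewrite -slice_coprod map_scalar_mx nxy slice_tmx lamP map_delta_mx.
    exact: rowE.
  by rewrite coprod_act_mx map_scalar_mx nxy act2_tmx.
exists r, mu, y, (map_mx (counit H) x); split=> //.
  exact: left_free_grouplike yfree ymu.
by apply: coprod_tmx_counit; rewrite map_scalar_mx.
Qed.

(** Multiplication after id (x) antipode, the map [c], is applied to psi mu = mu (x) mu. *)
Lemma grouplike_inverse n (mu : 'M[H]_n) :
  grouplike mu -> mu *m map_mx (antipode H) mu = 1%:M.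
Proof.
case=> mu2 mu1; pose c : G2 -> H := tlift (fun x y => x * antipode H y).
have cB : balanced (fun (a : k) (x : H) => x * etaR H a)
    (fun (a : k) (y : H) => etaL H a * y) (fun x y => x * antipode H y).
  split=> [x x' y|x y y'|a x y]; first by rewrite mulrDl.
    by rewrite rmorphD mulrDr.
  by rewrite rmorphM antipode_etaL mulrA.
have cA : zmod_morphism c.
  by move=> s t; apply: (addIr (c t)); rewrite -(tliftD cB) !subrK.
pose cM := GRing.isZmodMorphism.Build G2 H c cA.
pose C : {additive G2 -> H} := HB.pack c cM.
have CE x y : C (rinl x * rinr y) = x * antipode H y.
  by rewrite -rtens_split; apply: tliftE cB x y.
have : map_mx C (map_mx (coprod H) mu) = 1%:M.
  rewrite -[RHS](map_mx1 (etaL H)) -mu1.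
  by apply/matrixP=> i j; rewrite !mxE -antipoder.
rewrite mu2 => <-; apply/matrixP=> i j; rewrite !mxE raddf_sum.
by apply: eq_bigr => l _; rewrite !mxE CE.
Qed.

Lemma grouplike_block m n (mu : 'M[H]_m) (nu : 'M[H]_n) :
  grouplike mu -> grouplike nu -> grouplike (block_mx mu 0 0 nu).
Proof.
case=> mu2 mu1 [nu2 nu1]; split.
  rewrite /tmx !map_block_mx mulmx_block !map_mx0 !mul0mx !mulmx0 !addr0 !add0r.
  by rewrite mu2 nu2.
by rewrite map_block_mx mu1 nu1 !map_mx0 -scalar_mx_block.
Qed.

Lemma comodule_block m n p (mu : 'M[H]_m) (nu : 'M[H]_n) (u : 'M[H]_(m, p)) v :
    map_mx (coprod H) u = tmx mu u -> map_mx (coprod H) v = tmx nu v ->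
  map_mx (coprod H) (col_mx u v) = tmx (block_mx mu 0 0 nu) (col_mx u v).
Proof.
move=> um vn; rewrite /tmx map_block_mx !map_col_mx mul_block_col !map_mx0.
by rewrite !mul0mx addr0 add0r um vn.
Qed.

Lemma grouplike1 : grouplike (1%:M : 'M[H]_1).
Proof. by split; rewrite ?map_mx1 // /tmx !map_mx1 mulmx1. Qed.

End Grouplike.

(** * The kernel of the projection to Gamma' and comodules around its elements *)

Section UnitIdeal.
Variables (k : fieldType) (H : hopfAlgebroid k).

Local Notation "A ^L" := (map_mx (etaL H) A) (at level 2, format "A ^L").
Local Notation "A ^R" := (map_mx (etaR H) A) (at level 2, format "A ^R").

Definition unit_ideal (y : H) : Prop :=
  exists s : seq (k * H), y = \sum_(p <- s) (etaL H p.1 - etaR H p.1) * p.2.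

Lemma unit_ideal0 : unit_ideal 0.
Proof. by exists [::]; rewrite big_nil. Qed.

Lemma unit_idealD x y : unit_ideal x -> unit_ideal y -> unit_ideal (x + y).
Proof. by move=> [s ->] [t ->]; exists (s ++ t); rewrite big_cat. Qed.

Lemma unit_idealM x y : unit_ideal y -> unit_ideal (x * y).
Proof.
move=> [s ->]; exists [seq (p.1, x * p.2) | p <- s].
by rewrite big_map mulr_sumr; apply: eq_bigr => p _; rewrite mulrCA.
Qed.

Lemma unit_idealN x : unit_ideal x -> unit_ideal (- x).
Proof. by rewrite -mulN1r; apply: unit_idealM. Qed.

Lemma Phi_GammaE a b : Phi_Gamma H (a ⊗ b) = etaL H a * etaR H b.
Proof. exact: copairE. Qed.

Lemma Phi_mulE a b : Phi_mul H (a ⊗ b) = a * b.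
Proof. exact: copairE. Qed.

Lemma unit_ideal_Phi (p : Phi H) :
  unit_ideal (etaL H (Phi_mul H p) - Phi_Gamma H p).
Proof.
move: p; apply: tens_ind => [|a b p IHp].
  by rewrite !rmorph0 subrr; apply: unit_ideal0.
rewrite !rmorphD opprD addrACA; apply: unit_idealD => //.
rewrite Phi_GammaE Phi_mulE rmorphM -mulrBr; apply: unit_idealM.
by exists [:: (b, 1)]; rewrite big_seq1 mulr1.
Qed.

(** A formal sum of pairs (a, y) is evaluated to the sum of the etaL a * y. Each defining relation
    of k (x)_Phi Gamma changes this value by an element of the ideal, the balancing relation by
    [unit_ideal_Phi]. *)
Lemma assoc_proj_kernel y : assoc_proj H y = 0 -> unit_ideal y.
Proof.
pose v (s : seq (k * H)) := \sum_(p <- s) etaL H p.1 * p.2.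
have key s t : tens_eq (fun (p : Phi H) (x : k) => x * Phi_mul H p)
    (fun (p : Phi H) (y : H) => Phi_Gamma H p * y) s t -> unit_ideal (v s - v t).
  elim=> {s t} [s|s t _ Ist|s t u _ Ist _ Itu|s s' t t' _ Is _ It|s t|z|
    x x' z|x z z'|p x z].
  - by rewrite subrr; apply: unit_ideal0.
  - by rewrite -opprB; apply: unit_idealN.
  - by rewrite -[v s](subrK (v t)) -addrA; apply: unit_idealD.
  - by rewrite /v !big_cat /= opprD addrACA; apply: unit_idealD.
  - by rewrite /v !big_cat /= addrC subrr; apply: unit_ideal0.
  - by rewrite /v big_seq1 big_nil rmorph0 mul0r subrr; apply: unit_ideal0.
  - rewrite /v !big_cons !big_nil /= rmorphD mulrDl !addr0 subrr.
    exact: unit_ideal0.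
  - by rewrite /v !big_cons !big_nil /= mulrDr !addr0 subrr; apply: unit_ideal0.
  - rewrite /v !big_seq1 /= rmorphM -mulrA -mulrBr -mulrBl [_ * z]mulrC.
    by do 2 apply: unit_idealM; apply: unit_ideal_Phi.
move=> /tclassP/(key [:: (1, y)] [::]).
by rewrite /v big_seq1 big_nil rmorph1 mul1r subr0.
Qed.

Lemma Phi_Gamma_counit p : counit H (Phi_Gamma H p) = Phi_mul H p.
Proof. by rewrite -assoc_counit_subproof. Qed.

Lemma Phi_Gamma_rinl a : Phi_Gamma H (rinl a) = etaL H a.
Proof. by rewrite /rinl Phi_GammaE rmorph1 mulr1. Qed.

Lemma Phi_Gamma_rinr a : Phi_Gamma H (rinr a) = etaR H a.
Proof. by rewrite /rinr Phi_GammaE rmorph1 mul1r. Qed.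

Lemma Phi_mul_rinl a : Phi_mul H (rinl a) = a.
Proof. by rewrite /rinl Phi_mulE mulr1. Qed.

Lemma Phi_mul_rinr a : Phi_mul H (rinr a) = a.
Proof. by rewrite /rinr Phi_mulE mul1r. Qed.

(** A generator (etaL b - etaR b) n takes a finite comodule around n from [locally_finite]; the
    coefficients of n, multiplied by b (x) 1 - 1 (x) b, vanish under [Phi_mul]. Sums correspond to
    block sums. *)
Lemma unit_ideal_comodule y : unit_ideal y ->
  exists r (mu : 'M[H]_r) (u : 'cV[H]_r) (p : 'rV[Phi H]_r),
  [/\ grouplike mu, map_mx (coprod H) u = tmx mu u,
    y%:M = map_mx (Phi_Gamma H) p *m u & map_mx (Phi_mul H) p = 0].
Proof.
case=> s ->; elim: s => [|[b n] s [r [mu [u [p [gmu umu ye p0]]]]]].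
  exists 0, 0, 0, 0; rewrite big_nil mulmx0 raddf0; split=> //.
  - by split; apply/matrixP=> - [].
  - by apply/matrixP=> - [].
  - by apply/matrixP=> i j; rewrite !mxE mul0rn.
  - by apply/matrixP=> ? [].

have [r' [mu' [u' [d [gmu' umu' ne]]]]] := locally_finite n.
pose q : 'rV[Phi H]_r' := (rinl b - rinr b) *: map_mx rinl d.
exists (r' + r)%N, (block_mx mu' 0 0 mu), (col_mx u' u), (row_mx q p).
split; [exact: grouplike_block | exact: comodule_block | | ].
  rewrite big_cons raddfD /= ye map_row_mx mul_row_col; congr (_ + _).
  rewrite map_mxZ /= rmorphB Phi_Gamma_rinl Phi_Gamma_rinr -map_mx_comp.
  have -> : map_mx (Phi_Gamma H \o rinl) d = d^L.
    by apply: eq_map_mx => a; apply: Phi_Gamma_rinl.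
  by rewrite -scalemxAl -ne scale_scalar_mx.
rewrite map_row_mx p0 map_mxZ /= rmorphB Phi_mul_rinl Phi_mul_rinr subrr scale0r.
exact: row_mx0.
Qed.

(** The trivial comodule spanned by 1 is added to the one for x - 1. Then 1 and x are combinations
    of the same column, the coefficients p of x reduce to the coefficients v0 of 1, and v0 is
    primitive. *)
Lemma one_plus_unit_ideal_comodule x : unit_ideal (x - 1) ->
  exists r (mu : 'M[H]_r) (u : 'cV[H]_r) (v0 : 'rV[k]_r) (p : 'rV[Phi H]_r),
  [/\ grouplike mu, map_mx (coprod H) u = tmx mu u,
    v0^L *m u = 1%:M /\ v0^L *m mu = v0^R,
    x%:M = map_mx (Phi_Gamma H) p *m u & map_mx (Phi_mul H) p = v0].
Proof.
move=> /unit_ideal_comodule[r [mu [u [p [gmu umu ye p0]]]]].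
exists (1 + r)%N, (block_mx 1%:M 0 0 mu), (col_mx 1%:M u), (row_mx 1%:M 0).
exists (row_mx 1%:M p); split.
- by apply: grouplike_block => //; apply: grouplike1.
- by apply: comodule_block => //; rewrite /tmx !map_mx1 mulmx1.
- rewrite !map_row_mx !map_mx1 !map_mx0 mul_row_col mul_row_block.
  by rewrite !mul0mx !mulmx0 !mul1mx !addr0.
- by rewrite map_row_mx map_mx1 mul_row_col mul1mx -ye -raddfD /= addrC subrK.
- by rewrite map_row_mx p0 map_mx1.
Qed.

End UnitIdeal.

(** * The determinant argument in the bimodule spanned by t *)

(** Write P = Z adj(Y Z) Y. From P Z = D Z, multiplication by adj Z on the right gives det Z P = D
    det Z, and then multiplication by det Y gives the claim. The extra factor D replaces the
    invertibility of Z. *)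
Lemma det_mulmx_adj (R : comPzRingType) n (Y Z : 'M[R]_n) :
  let D := \det (Y *m Z) in D *: (Z *m \adj (Y *m Z) *m Y) = (D * D)%:M.
Proof.
move=> D; set P := Z *m _ *m Y.
have PZ : P *m Z = D *: Z.
  by rewrite /P -!mulmxA mul_adj_mx scalar_mxC mul_scalar_mx.
have PdZ : \det Z *: P = (D * \det Z)%:M.
  rewrite -[P]mulmx1 scalemxAr scalemx1 -mul_mx_adj mulmxA PZ -scalemxAl.
  by rewrite mul_mx_adj scale_scalar_mx.
by rewrite {1}/D det_mulmx -scalerA PdZ scale_scalar_mx mulrCA -det_mulmx.
Qed.

Section Bimodule.
Variables (k : fieldType) (H : hopfAlgebroid k).

Local Notation "A ^L" := (map_mx (etaL H) A) (at level 2, format "A ^L").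
Local Notation "A ^R" := (map_mx (etaR H) A) (at level 2, format "A ^R").
Local Notation "A ^J" := (map_mx (Phi_Gamma H) A) (at level 2, format "A ^J").

Lemma act_comodule (lam : functional H) n p (mu : 'M[H]_n) (u : 'M[H]_(n, p)) q
    (C : 'M[k]_(q, n)) :
    map_mx (coprod H) u = tmx mu u ->
  map_mx (act lam) (C^L *m u) = (map_mx lam (C^L *m mu))^L *m u.
Proof.
by move=> umu; rewrite -slice_coprod coprod_mulL umu tmx_mulL slice_tmx.
Qed.

(** [act lam] is right linear, so it changes only left coefficients: a (x) b at position i becomes
    lam (etaL a * mu_ij) (x) b at each j. Right linearity of lam then identifies the reduction of q,
    which ties values of functionals to stability under [act]. *)
Lemma act_bimodule (lam : functional H) n (mu : 'M[H]_n) (u : 'cV[H]_n)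
    (p : 'rV[Phi H]_n) :
    map_mx (coprod H) u = tmx mu u ->
  exists q : 'rV[Phi H]_n, map_mx (act lam) (p^J *m u) = q^J *m u
    /\ map_mx (Phi_mul H) q = map_mx lam (p^J *m mu).
Proof.
move=> umu; rewrite (row_sum_delta p); elim/big_ind: _ => [|p1 p2|i _].
- by exists 0; rewrite !map_mx0 !mul0mx !map_mx0.
- move=> [q1 [a1 b1]] [q2 [a2 b2]]; exists (q1 + q2).
  by rewrite !map_mxD !mulmxDl !map_mxD a1 a2 b1 b2.
move: (p 0 i); apply: tens_ind => [|a b t [q [a2 b2]]].
  by exists 0; rewrite scale0r !map_mx0 !mul0mx !map_mx0.
pose e : 'rV[k]_n := a *: delta_mx 0 i; pose c := map_mx lam (e^L *m mu).
pose q1 : 'rV[Phi H]_n := \row_j (c 0 j ⊗ b : Phi H).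
have E m (v : 'M[H]_(n, m)) :
    ((a ⊗ b : Phi H) *: delta_mx 0 i)^J *m v = etaR H b *: (e^L *m v).
  rewrite scalemxAl; congr (_ *m _).
  apply/matrixP=> j l; rewrite !mxE rmorphM /= [in LHS]Phi_GammaE.
  by rewrite !rmorphM !rmorph_nat mulrA [_ * etaL _ _]mulrC.
have actZ m (v : 'rV[H]_m) : map_mx (act lam) (etaR H b *: v) =
    etaR H b *: map_mx (act lam) v.
  by apply/matrixP=> j l; rewrite !mxE mulrC actR mulrC.
have lamZ m (v : 'rV[H]_m) : map_mx lam (etaR H b *: v) = b *: map_mx lam v.
  by apply/matrixP=> j l; rewrite !mxE mulrC functionalR mulrC.
exists (q1 + q); rewrite scalerDl !map_mxD !mulmxDl !map_mxD a2 b2 !E actZ lamZ.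
split; congr (_ + _).
  rewrite (act_comodule _ _ umu) -/c scalemxAl; congr (_ *m _).
  by apply/matrixP=> j l; rewrite !mxE /= Phi_GammaE mulrC !ord1.
by apply/matrixP=> j l; rewrite !mxE /= Phi_mulE mulrC !ord1.
Qed.

(* The p : 'rV[Phi H]_r with p u in the bimodule spanned by t form a Phi-submodule
   K. Let the rows of X in K lift a basis B of its image under Phi_mul, and
   B C = 1. Stability of K under [act] factors X^J through the invertible matrix
   mu as Y E, and Cramer's rule for det (X C) = det Y * det (E C) produces the
   element a = det (X C) ^ 2. *)
Lemma bimodule_counit_one s (g : 'M[H]_s) (t : 'cV[H]_s) (x : H) (p0 : 'rV[Phi H]_s) :
    map_mx (coprod H) t = tmx g t -> x%:M = p0^J *m t -> unit_ideal (x - 1) ->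
  exists (a : Phi H) (p : 'rV[Phi H]_s),
    (Phi_Gamma H a)%:M = p^J *m t /\ Phi_mul H a = 1.
Proof.
move=> tg xt /one_plus_unit_ideal_comodule.
move=> [r [mu [u [v0 [p1 [gmu umu [v0u v0mu] xu p1v0]]]]]].
pose K (q : 'rV[Phi H]_r) := exists p : 'rV[Phi H]_s, q^J *m u = p^J *m t.
pose P v := exists q, K q /\ map_mx (Phi_mul H) q = v.
have P0 : P 0.
  by exists 0; split; [exists 0; rewrite !map_mx0 !mul0mx | rewrite map_mx0].
have PD a v w : P v -> P w -> P (a *: v + w).
  move=> [q [[p qp] <-]] [q' [[p' qp'] <-]]; exists (rinl a *: q + q'); split.
    exists (rinl a *: p + p').
    by rewrite !map_mxD !map_mxZ !mulmxDl -!scalemxAl qp qp'.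
  by rewrite map_mxD map_mxZ /= Phi_mul_rinl.
have [m [B [Bfree PB]]] := subspace_row_base P0 PD.
have [C BC] := row_freeP Bfree.
(* By [act_bimodule], the value of lam on q mu is the reduction of another element of [K], so it
   lies in the row space of [B]. *)
have Kmu q : K q -> q^J *m mu = q^J *m mu *m C^R *m B^R.
  move=> [p qp]; apply: functional_row_factor => // lam; apply/PB.
  have [q' [q'u <-]] := act_bimodule lam q umu.
  have [p' [p't _]] := act_bimodule lam p tg.
  by exists q'; split=> //; exists p'; rewrite -q'u qp p't.
have Prow i : exists qp : 'rV[Phi H]_r * 'rV[Phi H]_s,
    qp.1^J *m u = qp.2^J *m t /\ map_mx (Phi_mul H) qp.1 = row i B.
  have /PB[q [[p qp] qB]] : (row i B <= B)%MS := row_sub i B.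
  by exists (q, p).
have [f fP] := choice Prow.
pose X := \matrix_i (f i).1; pose W := \matrix_i (f i).2.
have XB : map_mx (Phi_mul H) X = B.
  by apply/row_matrixP=> i; rewrite -map_row rowK; have [] := fP i.
have XW : X^J *m u = W^J *m t.
  apply/row_matrixP=> i; rewrite !row_mul -!map_row !rowK.
  by have [] := fP i.
pose Y := X^J *m mu *m C^R; pose E := B^R *m map_mx (antipode H) mu.
have XYE : X^J = Y *m E.
  rewrite /E mulmxA -[LHS]mulmx1 -(grouplike_inverse gmu) mulmxA; congr (_ *m _).
  apply/row_matrixP=> i; rewrite /Y !row_mul -!map_row rowK; apply: Kmu.
  by exists (f i).2; have [] := fP i.
(* Here x enters: p1 u and p0 t both equal x, so p1 is in [K] and its reduction v0 is a combination
   of the rows of [B]. *)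
have /PB/submxP[d v0d] : P v0 by exists p1; split=> //; exists p0; rewrite -xu xt.
have v0E : v0^L = d^R *m E.
  rewrite -[LHS]mulmx1 -(grouplike_inverse gmu) mulmxA v0mu v0d map_mxM.
  by rewrite mulmxA.
pose C1 : 'M[Phi H]_(r, m) := map_mx rinl C.
pose w1 : 'rV[Phi H]_r := map_mx rinl v0.
have C1J : C1^J = C^L by apply/matrixP=> i j; rewrite !mxE Phi_Gamma_rinl.
have w1J : w1^J = v0^L by apply/matrixP=> i j; rewrite !mxE Phi_Gamma_rinl.
pose Z := E *m C^L.
pose D := \det (X *m C1).
have YZ : (X *m C1)^J = Y *m Z by rewrite map_mxM C1J XYE -mulmxA.
have DJ : Phi_Gamma H D = \det (Y *m Z) by rewrite -det_map_mx YZ.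
(* Since v0 = d E and v0 u = 1, D^2 = d D^2 E u = D d Z adj(Y Z) Y E u, where d Z = v0 C and Y E u =
   X u = W t. The counit of D is det (B C) = 1. *)
exists (D * D), (D *: (w1 *m C1 *m \adj (X *m C1) *m W)); split; last first.
  have D1 : Phi_mul H D = 1.
    rewrite -det_map_mx map_mxM XB.
    have -> : map_mx (Phi_mul H) C1 = C.
      by apply/matrixP=> i j; rewrite !mxE Phi_mul_rinl.
    by rewrite BC det1.
  by rewrite rmorphM /= D1 mulr1.
rewrite map_mxZ !map_mxM /= -scalemxAl -(mulmxA _ W^J) -XW XYE.
rewrite map_mx_adj YZ w1J C1J v0E -(mulmxA d^R) -/Z DJ.
have -> : d^R *m Z *m \adj (Y *m Z) *m (Y *m E *m u) =
    d^R *m (Z *m \adj (Y *m Z) *m Y) *m (E *m u) by rewrite !mulmxA.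
rewrite scalemxAl scalemxAr det_mulmx_adj rmorphM /= DJ.
by rewrite mul_mx_scalar -scalemxAl mulmxA -v0E v0u scalemx1.
Qed.

End Bimodule.

(** * From a primitive over Gamma' to a primitive over Gamma *)

Section Primitives.
Variables (k : fieldType) (H : hopfAlgebroid k).

Local Notation "A ^L" := (map_mx (etaL H) A) (at level 2, format "A ^L").
Local Notation "A ^R" := (map_mx (etaR H) A) (at level 2, format "A ^R").
Local Notation "A ^J" := (map_mx (Phi_Gamma H) A) (at level 2, format "A ^J").

Lemma act_etaL (lam : functional H) a : act lam (etaL H a) = etaL H (lam (etaL H a)).
Proof.
by rewrite /act coprod_etaL rtens_split sliceE mulr1.
Qed.

Lemma act1 (lam : functional H) : act lam 1 = etaL H (lam 1).
Proof. by rewrite -(rmorph1 (etaL H)) act_etaL. Qed.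

Lemma act_scalar_mx (lam : functional H) n x :
  map_mx (act lam) (x%:M : 'M_n) = (act lam x)%:M.
Proof. by apply/matrixP=> i j; rewrite !mxE raddfMn. Qed.

Lemma act_etaR (lam : functional H) b :
  act lam (etaR H b) = etaL H (lam 1) * etaR H b.
Proof. by rewrite -[in LHS](mul1r (etaR H b)) actR act1. Qed.

Definition bimodule_sum (s : seq (k * k)) : H :=
  \sum_(p <- s) etaL H p.1 * etaR H p.2.

Lemma act_bimodule_sum (lam : functional H) s :
  act lam (bimodule_sum s) = \sum_(p <- s) etaL H (lam (etaL H p.1)) * etaR H p.2.
Proof.
rewrite raddf_sum; apply: eq_bigr => p _ /=. by rewrite actR act_etaL.
Qed.

Lemma Phi_Gamma_sum (a : Phi H) : exists s, Phi_Gamma H a = bimodule_sum s.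
Proof.
move: a; apply: tens_ind => [|a b t [s ts]].
  by exists [::]; rewrite rmorph0 /bimodule_sum big_nil.
by exists ((a, b) :: s); rewrite /bimodule_sum big_cons rmorphD [X in X + _]Phi_GammaE ts.
Qed.

(* A shortest nonzero sum in C, normalised to start with 1 (x) b, is killed   *)
(* by act lam - lam 1 for every lam, hence is primitive.                      *)
Lemma bimodule_sum_one (C : H -> Prop) :
    (forall x y, C x -> C y -> C (x - y)) ->
    (forall a b x, C x -> C (etaL H a * x * etaR H b)) ->
    (forall (lam : functional H) x, C x -> C (act lam x)) ->
  forall s, bimodule_sum s != 0 -> C (bimodule_sum s) -> C 1.
Proof.
move=> CB CM Cact s; move: {2}(size s) (leqnn (size s)) => n.
elim: n s => [|n IHn] [|[a b] s] //= sn; do ?by rewrite /bimodule_sum big_nil eqxx.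
have [-> |a0] := eqVneq a 0.
  rewrite /bimodule_sum big_cons rmorph0 mul0r add0r; exact: IHn.
move=> f0 Cf; pose r := [seq (a^-1 * p.1, p.2) | p <- s].
pose f := etaR H b + bimodule_sum r.
have fE : etaL H a^-1 * bimodule_sum ((a, b) :: s) = f.
  rewrite /bimodule_sum big_cons mulrDr mulrA -rmorphM mulVf // rmorph1 mul1r.
  congr (_ + _); rewrite mulr_sumr /r /bimodule_sum big_map.
  by apply: eq_bigr => p _; rewrite mulrA -rmorphM.
have {}f0 : f != 0.
  apply: contra_neq f0 => f0; rewrite -[LHS]mul1r -(rmorph1 (etaL H)) -(mulfV a0).
  by rewrite rmorphM -mulrA fE f0 mulr0.
have {Cf fE} Cf : C f.
  by have := CM a^-1 1 _ Cf; rewrite fE rmorph1 mulr1.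
have [[lam lf]|nlam] :=
    pselect (exists lam : functional H, act lam f != etaL H (lam 1) * f).
  (* The leading term etaR b cancels in act lam f - etaL (lam 1) f, which is nonzero by the choice
     of lam and shorter than the original sum. *)
  pose r' := [seq (lam (etaL H p.1) - lam 1 * p.1, p.2) | p <- r].
  have r'E : bimodule_sum r' = act lam f - etaL H (lam 1) * f.
    have fr : act lam f = etaL H (lam 1) * etaR H b +
        \sum_(p <- r) etaL H (lam (etaL H p.1)) * etaR H p.2.
      by rewrite /f raddfD /= act_etaR act_bimodule_sum.
    rewrite fr mulrDr opprD addrACA subrr add0r mulr_sumr -sumrB.
    rewrite /bimodule_sum big_map; apply: eq_bigr => p _ /=.
    by rewrite mulrA -rmorphM -mulrBl -rmorphB.
  apply: (IHn r'); first by rewrite !size_map.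
    by rewrite r'E subr_eq0.
  rewrite r'E; apply: CB; first exact: Cact.
  by have := CM (lam 1) 1 _ Cf; rewrite rmorph1 mulr1.
(* Applying the counit to act lam f = etaL (lam 1) f gives lam f = lam 1 * counit f, which is lam of
   etaR (counit f). *)
have fR : f = etaR H (counit H f).
  apply/subr0_eq/functionals_separate => lam; rewrite raddfB /=.
  have lf : act lam f = etaL H (lam 1) * f.
    by apply/eqP/negPn/negP => lf; apply: nlam; exists lam.
  rewrite -counit_act lf rmorphM /= counit_etaL.
  by rewrite -[etaR H _]mul1r functionalR subrr.
have e0 : counit H f != 0 by apply: contra_neq f0 => e0; rewrite fR e0 rmorph0.
have := CM 1 (counit H f)^-1 _ Cf.
by rewrite rmorph1 mul1r {1}fR -rmorphM mulfV // rmorph1.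
Qed.

Lemma act_mulR (lam : functional H) m n p (b : 'M[k]_(m, n)) (A : 'M[H]_(n, p)) :
  map_mx (act lam) (b^R *m A) = b^R *m map_mx (act lam) A.
Proof.
apply/matrixP=> i j; rewrite !mxE raddf_sum; apply: eq_bigr => l _.
by rewrite !mxE /= mulrC actR mulrC.
Qed.

(** A row v stands for an element of the comodule and v^L g lists the coefficients of its coaction,
    so these are the subcomodules, described by functionals. *)
Definition stable n (g : 'M[H]_n) (P : 'rV[k]_n -> Prop) :=
  [/\ P 0, forall a u v, P u -> P v -> P (a *: u + v)
    & forall (lam : functional H) v, P v -> P (map_mx lam (v^L *m g))].

Definition irreducible n (g : 'M[H]_n) := forall P v w,
  stable g P -> P v -> v != 0 -> P w.

(** The coefficients of 1 (x) a are the etaR a_j, since scalars cross the tensor sign through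
    [etaR]. *)
Definition has_primitive n (g : 'M[H]_n) :=
  exists2 a : 'rV[k]_n, a != 0 & a^L *m g = a^R.

(* t is a comodule map to Gamma. If some relation sum_i L(W_i) t R(b_i) = 0   *)
(* has a nonzero row W_i, then by irreducibility W_i may be prescribed, which *)
(* shortens the representation of 1; otherwise the map W |-> sum is injective *)
(* and W is primitive because 1 is.                                           *)
Lemma primitive_of_one n (g : 'M[H]_n) (t : 'cV[H]_n) m (b : 'rV[k]_m)
    (W : 'M[k]_(m, n)) :
    irreducible g -> map_mx (coprod H) t = tmx g t ->
  b^R *m W^L *m t = 1%:M -> has_primitive g.
Proof.
move=> girr tg; elim: m b W => [|m IHm] b W bWt.
  have /matrixP/(_ 0 0) : (1%:M : 'M[H]_1) = 0.
    by rewrite -bWt [b]thinmx0 map_mx0 !mul0mx.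
  rewrite !mxE /= => /(congr1 (counit H)); rewrite rmorph1 rmorph0 => /eqP.
  by rewrite oner_eq0.
pose N (V : 'M[k]_(m.+1, n)) := b^R *m V^L *m t = 0.
have actN (lam : functional H) V : map_mx (act lam) (b^R *m V^L *m t) =
    b^R *m (map_mx lam (V^L *m g))^L *m t.
  by rewrite -mulmxA act_mulR (act_comodule lam V tg) mulmxA.
have N0 : N 0 by rewrite /N map_mx0 mulmx0 mul0mx.
have ND a U V : N U -> N V -> N (a *: U + V).
  rewrite /N map_mxD map_mxZ mulmxDr mulmxDl -scalemxAr -scalemxAl => -> ->.
  by rewrite scaler0 addr0.
have [[V [i [NV Vi0]]]|N_0] := pselect (exists V i, N V /\ row i V != 0).
  pose P v := exists V, N V /\ row i V = v.
  have Pst : stable g P.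
    split=> [|a u v [U [NU <-]] [U' [NU' <-]]|lam v [U [NU <-]]].
    - by exists 0; rewrite row0.
    - by exists (a *: U + U'); split; [exact: ND | rewrite raddfD /= linearZ].
    exists (map_mx lam (U^L *m g)); split.
      by rewrite /N -actN NU map_mx0.
    by rewrite -map_row row_mul -map_row.
  have [U [NU UW]] : P (row i W) by apply: girr Pst _ Vi0; exists V.
  apply: (IHm (col' i b) (row' i (W - U))).
  have W'U : b^R *m (W - U)^L *m t = 1%:M.
    by rewrite map_mxB mulmxBr mulmxBl bWt NU subr0.
  rewrite -W'U; congr (_ *m _); apply/matrixP=> r j; rewrite !mxE.
  rewrite [RHS](bigD1_ord i) //= !mxE.
  have /rowP/(_ j) := UW; rewrite !mxE => ->; rewrite subrr rmorph0 mulr0 add0r.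
  by apply: eq_bigr => l _; rewrite !mxE.
have {}N_0 V : N V -> V = 0.
  move=> NV; apply/row_matrixP=> i; rewrite row0; apply/eqP/negPn/negP => Vi0.
  by apply: N_0; exists V, i.
(* [act lam] sends the sum for [W], which is 1, to etaL (lam 1), and this is also the sum for lam 1
   *: W. The difference of the two coefficient matrices therefore lies in [N]. *)
have Wg : W^L *m g = W^R.
  apply/subr0_eq/functionals_separate_mx => lam; rewrite map_mxB.
  have -> : map_mx lam W^R = lam 1 *: W.
    by apply/matrixP=> i j; rewrite !mxE -[etaR H _]mul1r functionalR.
  apply: N_0; rewrite /N map_mxB mulmxBr mulmxBl -actN bWt map_mxZ /=.
  rewrite -scalemxAr -scalemxAl bWt act_scalar_mx act1 scale_scalar_mx.
  by rewrite mulr1 subrr.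
have [i Wi0] : exists i, row i W != 0.
  apply/existsP; rewrite -negb_forall; apply/negP => /forallP W0.
  have {}W0 : W = 0 by apply/row_matrixP=> i; rewrite row0; apply/eqP.
  move: bWt; rewrite W0 map_mx0 mulmx0 mul0mx => /matrixP/(_ 0 0).
  rewrite !mxE /= => /(congr1 (counit H)); rewrite rmorph1 rmorph0 => /eqP.
  by rewrite eq_sym oner_eq0.
by exists (row i W) => //; rewrite !map_row -row_mul Wg.
Qed.

Lemma Phi_row_sum n (p : 'rV[Phi H]_n) : exists m (b : 'rV[k]_m) (W : 'M[k]_(m, n)),
  p^J = b^R *m W^L.
Proof.
rewrite (row_sum_delta p); elim/big_ind: _ => [|p1 p2|i _].
- by exists 0, 0, 0; rewrite !map_mx0 mul0mx.
- move=> [m1 [b1 [W1 E1]]] [m2 [b2 [W2 E2]]].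
  exists (m1 + m2)%N, (row_mx b1 b2), (col_mx W1 W2).
  by rewrite map_mxD map_row_mx map_col_mx mul_row_col E1 E2.
move: (p 0 i); apply: tens_ind => [|a b t [m [c [W E]]]].
  by exists 0, 0, 0; rewrite scale0r !map_mx0 mul0mx.
exists (1 + m)%N, (row_mx b%:M c), (col_mx (a *: delta_mx 0 i) W).
rewrite scalerDl map_mxD map_row_mx map_col_mx mul_row_col E; congr (_ + _).
rewrite map_scalar_mx mul_scalar_mx.
apply/matrixP=> j l; rewrite !mxE [LHS]rmorphM [X in X * _]Phi_GammaE.
by rewrite !rmorphM !rmorph_nat mulrA [_ * etaL _ _]mulrC.
Qed.

(** The last hypothesis says that a becomes primitive over Gamma'. A linear form f with a f = 1
    turns it into a single congruence to 1, from which [bimodule_counit_one] and [bimodule_sum_one]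
    produce 1 itself. *)
Lemma primitive_of_assoc_primitive n (g : 'M[H]_n) (a : 'rV[k]_n) :
    irreducible g -> grouplike g -> a != 0 ->
    (forall j, unit_ideal ((a^L *m g) 0 j - a^R 0 j)) ->
  has_primitive g.
Proof.
move=> girr [gg _] a0 aI.
have [f af] : exists f, a *m f = 1%:M.
  apply/row_freeP; rewrite /row_free; rewrite -mxrank_eq0 in a0.
  by rewrite eqn_leq lt0n a0 rank_leq_row.
pose t := g *m f^R; have tg : map_mx (coprod H) t = tmx g t.
  by rewrite /t coprod_mulR gg tmx_mulR.
pose x := (a^L *m t) 0 0.
have xt : x%:M = (map_mx rinl a : 'rV[Phi H]_n)^J *m t.
  rewrite -[LHS]mx11_scalar; congr (_ *m _).
  by apply/matrixP=> i j; rewrite !mxE Phi_Gamma_rinl.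
have xI : unit_ideal (x - 1).
  have -> : x - 1 = ((a^L *m g - a^R) *m f^R) 0 0.
    by rewrite mulmxBl -mulmxA -/t -map_mxM af map_mx1 /x !mxE.
  rewrite mxE; elim/big_ind: _ => [||j _]; first exact: unit_ideal0.
    exact: unit_idealD.
  by rewrite mulrC; apply: unit_idealM; have := aI j; rewrite !mxE.
have [c [p [cp c1]]] := bimodule_counit_one tg xt xI.
pose C y := exists p : 'rV[Phi H]_n, y%:M = p^J *m t.
have [s cs] := Phi_Gamma_sum c.
have C1 : C 1.
  apply: (@bimodule_sum_one C _ _ _ s).
  - move=> y z [q yq] [r zr]; exists (q - r).
    by rewrite raddfB /= yq zr map_mxB mulmxBl.
  - move=> d b y [q yq]; exists ((d ⊗ b : Phi H) *: q).
    rewrite map_mxZ -scalemxAl -yq scale_scalar_mx; congr _%:M.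
    by rewrite /= Phi_GammaE mulrAC.
  - move=> lam y [q yq]; have [r [E _]] := act_bimodule lam q tg.
    by exists r; rewrite -E -yq act_scalar_mx.
  - rewrite -cs; apply: contra_eq_neq c1 => c0.
    by rewrite -Phi_Gamma_counit c0 rmorph0 eq_sym oner_eq0.
  - by exists p; rewrite -cs.
have {p cp} [p p1] := C1; have [m [b [W pbW]]] := Phi_row_sum p.
by apply: (@primitive_of_one _ g t m b W) => //; rewrite -pbW.
Qed.

(** Induction on n: a reducible g has a proper nonzero subcomodule, and a primitive of the
    subcomodule is one of g. *)
Lemma irreducible_reduction n (g : 'M[H]_n) : grouplike g -> (0 < n)%N ->
    (forall m (h : 'M[H]_m), grouplike h -> (0 < m)%N -> irreducible h -> has_primitive h) ->
  has_primitive g.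
Proof.
move=> gg n0 irrP; have [m mn] := ubnP n.
elim: m n g gg n0 mn => // m IHm n g gg n0 nm.
have [girr|] := pselect (irreducible g); first exact: irrP.
move=> gred; have {gred} [P [v [w [[P0 PD Pg] Pv v0 nPw]]]] :
    exists P v w, [/\ stable g P, P v, v != 0 & ~ P w].
  apply: contra_notP gred => nex P v w Pst Pv v0; apply: contra_notP nex => nPw.
  by exists P, v, w.
have [r [B [Bfree PB]]] := subspace_row_base P0 PD.
have [C BC] := row_freeP Bfree.
(* The matrix of the coaction on the subcomodule in the basis [B]; the right inverse [C] extracts
   coordinates. *)
pose h := B^L *m g *m C^R.
have Bg : B^L *m g = h *m B^R.
  apply/row_matrixP=> i; rewrite !row_mul; apply: functional_row_factor => // lam.
  by rewrite -map_row; apply/PB/Pg/PB/row_sub.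
have r0 : (0 < r)%N.
  move/PB: Pv => vB; rewrite lt0n; apply: contra_neq v0 => r0.
  case/submxP: vB => c ->; move: c B {PB Bfree BC h Bg}; rewrite r0 => c B.
  by rewrite [c]thinmx0 mul0mx.
have rn : (r < n)%N.
  rewrite ltn_neqAle; apply/andP; split; last first.
    by rewrite -(eqP Bfree) rank_leq_col.
  apply/eqP=> rn; apply: nPw; apply/PB; apply: submx_full.
  by rewrite /row_full (eqP Bfree) rn.
have hg : grouplike h.
  split.
    rewrite [in LHS]/h coprod_mulR coprod_mulL (grouplike_coprod gg) tmx_mulL.
    by rewrite tmx_mulR Bg tmx_bal mulmxA.
  rewrite /h !map_mxM (grouplike_counit gg) mulmx1 -BC; congr (_ *m _).
    by apply/matrixP=> i j; rewrite !mxE counit_etaL.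
  by apply/matrixP=> i j; rewrite !mxE counit_etaR.
have [c c0 ch] := IHm r h hg r0 (leq_trans rn nm).
exists (c *m B).
  by rewrite -(mul0mx _ B) (inj_eq (row_free_inj Bfree)).
by rewrite map_mxM -mulmxA Bg mulmxA ch map_mxM.
Qed.

End Primitives.

(** * Translation between finite dimensional comodules and grouplike matrices *)

Lemma balanced_sum (K : Type) (M N A : zmodType) (ra : K -> M -> M) (la : K -> N -> N)
    (f : M -> N -> A) (I : Type) (r : seq I) (F : I -> tensor ra la) :
  balanced ra la f -> tlift f (\sum_(i <- r) F i) = \sum_(i <- r) tlift f (F i).
Proof.
by move=> fB; apply: (big_morph _ (tliftD fB) (tlift0 fB)).
Qed.

Section TensorSums.
Variables (K : Type) (M N : zmodType) (ra : K -> M -> M) (la : K -> N -> N).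

Lemma tens_pure_suml (I : Type) (r : seq I) (F : I -> M) (y : N) :
  (\sum_(i <- r) F i) ⊗ y = \sum_(i <- r) F i ⊗ y :> tensor ra la.
Proof.
apply: (big_morph (fun x => x ⊗ y : tensor ra la)) => [x x'|].
  exact: tens_pureDl.
by apply/tclassP/tens_eq0l.
Qed.

Lemma tens_pure_sumr (I : Type) (r : seq I) (x : M) (F : I -> N) :
  x ⊗ (\sum_(i <- r) F i) = \sum_(i <- r) x ⊗ F i :> tensor ra la.
Proof.
apply: (big_morph (fun y => x ⊗ y : tensor ra la)) => [y y'|].
  exact: tens_pureDr.
by apply: (addrI (x ⊗ 0 : tensor ra la)); rewrite -tens_pureDr !addr0.
Qed.

End TensorSums.

Section Comodules.
Variables (k : fieldType) (H : hopfAlgebroid k).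

Local Notation G2 := (rtensor (etaR H) (etaL H)).
Local Notation "A ^L" := (map_mx (etaL H) A) (at level 2, format "A ^L").
Local Notation "A ^R" := (map_mx (etaR H) A) (at level 2, format "A ^R").
Local Notation bal2 := (balanced (fun (a : k) (x : H) => x * etaR H a)
  (fun (a : k) (y : H) => etaL H a * y)).

Section OneModule.
Variable V : lmodType k.
Local Notation balV := (balanced (fun (a : k) (x : H) => x * etaR H a)
  (fun (a : k) (v : V) => a *: v)).
Local Notation balVV := (balanced (fun (a : k) (x : H) => x * etaR H a)
  (fun (a : k) (t : cotensor H V) => a *: t)).
Local Notation VV := (cotensor H (cotensor H V)).

Lemma cotens_scale_pure a x (w : V) :
  a *: (x ⊗ w : cotensor H V) = (etaL H a * x) ⊗ w.
Proof. exact: cotens_scaleE. Qed.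

Lemma cotens_insert_bal w :
  bal2 (fun x1 x2 => x1 ⊗ (x2 ⊗ w : cotensor H V) : VV).
Proof.
split=> [x x' y|x y y'|a x y]; first by rewrite tens_pureDl.
  by rewrite tens_pureDl tens_pureDr.
rewrite tens_pure_bal; congr (_ ⊗ _); exact: cotens_scaleE.
Qed.

(** This is psi x (x) w rebracketed into Gamma (x) (Gamma (x) V), as on the left side of
    coassociativity. *)
Definition coprod_insert (x : H) (w : V) : VV :=
  tlift (fun x1 x2 => x1 ⊗ (x2 ⊗ w : cotensor H V) : VV) (coprod H x).

Lemma coprod_insert_bal : balV coprod_insert.
Proof.
rewrite /coprod_insert; split=> [x x' w|x w w'|a x w].
- by rewrite rmorphD (tliftD (cotens_insert_bal w)).
- move: (coprod H x); apply: tens_ext => [s t|s t|x1 x2].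
  + exact: tliftD (cotens_insert_bal _) s t.
  + by rewrite !(tliftD (cotens_insert_bal _)) addrACA.
  + by rewrite !(tliftE (cotens_insert_bal _)) !tens_pureDr.
- rewrite rmorphM coprod_etaR.
  move: (coprod H x); apply: tens_ext => [s t|s t|x1 x2].
  + by rewrite mulrDl (tliftD (cotens_insert_bal _)).
  + exact: tliftD (cotens_insert_bal _) s t.
  + rewrite rtensM mulr1 !(tliftE (cotens_insert_bal _)).
    by rewrite tens_pure_bal.
Qed.

Lemma counit_scale_bal : balV (fun x w => counit H x *: w).
Proof.
split=> [x x' w|x w w'|a x w]; first by rewrite rmorphD scalerDl.
  exact: scalerDr.
by rewrite rmorphM counit_etaR scalerA.
Qed.

Section Coordinate.
Variable phi : {scalar V}.

(** This is id (x) phi, with Gamma (x)_k k identified with Gamma. For a coordinate form phi it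
    extracts a coefficient. *)
Definition cotens_form : cotensor H V -> H := tlift (fun x w => x * etaR H (phi w)).

Lemma cotens_form_bal : balV (fun x w => x * etaR H (phi w)).
Proof.
split=> [x x' w|x w w'|a x w]; first by rewrite mulrDl.
  by rewrite raddfD rmorphD mulrDr.
by rewrite linearZ /= rmorphM mulrA.
Qed.

Lemma cotens_formE x w : cotens_form (x ⊗ w) = x * etaR H (phi w).
Proof. exact: tliftE cotens_form_bal x w. Qed.

Lemma cotens_formD s t : cotens_form (s + t) = cotens_form s + cotens_form t.
Proof. exact: tliftD cotens_form_bal s t. Qed.

Lemma cotens_form_sum n (F : 'I_n -> cotensor H V) :
  cotens_form (\sum_i F i) = \sum_i cotens_form (F i).
Proof. exact: balanced_sum cotens_form_bal. Qed.

Lemma cotens_formZ a t : cotens_form (a *: t) = etaL H a * cotens_form t.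
Proof.
move: t; apply: tens_ext => [s t|s t|x w].
- by rewrite scalerDr cotens_formD.
- by rewrite cotens_formD mulrDr.
by rewrite cotens_scale_pure !cotens_formE mulrA.
Qed.

Definition cotens_form2 : VV -> G2 := tlift (fun x t => rinl x * rinr (cotens_form t)).

Lemma cotens_form2_bal : balVV (fun x t => rinl x * rinr (cotens_form t) : G2).
Proof.
split=> [x x' t|x t t'|a x t]; first by rewrite raddfD mulrDl.
  by rewrite cotens_formD raddfD mulrDr.
by rewrite cotens_formZ rmorphM /= rinlr [in RHS]rmorphM mulrA.
Qed.

Lemma cotens_form2E x t : cotens_form2 (x ⊗ t) = rinl x * rinr (cotens_form t).
Proof. exact: tliftE cotens_form2_bal x t. Qed.

Lemma cotens_form2_sum n (F : 'I_n -> VV) :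
  cotens_form2 (\sum_i F i) = \sum_i cotens_form2 (F i).
Proof. exact: balanced_sum cotens_form2_bal. Qed.

Lemma cotens_form2_insert x w :
  cotens_form2 (coprod_insert x w) = coprod H x * rinr (etaR H (phi w)).
Proof.
rewrite /coprod_insert; move: (coprod H x); apply: tens_ext => [s t|s t|x1 x2].
- by rewrite (tliftD (cotens_insert_bal w)) [LHS](tliftD cotens_form2_bal).
- by rewrite mulrDl.
rewrite (tliftE (cotens_insert_bal w)) cotens_form2E cotens_formE.
by rewrite [in RHS]rtens_split -mulrA -rmorphM.
Qed.

End Coordinate.
End OneModule.

(** The space k^n becomes a comodule by sending e_i to the sum of the g_ij (x) e_j. Unipotence
    provides a primitive vector, and comparing coordinates shows that it is the required row. *)
Lemma unipotent_has_primitive n (g : 'M[H]_n) :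
  unipotent H -> grouplike g -> (0 < n)%N -> has_primitive g.
Proof.
move=> uH [gg g1] n0; pose V : vectType k := 'rV[k]_n.
pose rho (v : V) : cotensor H V := \sum_j ((v^L *m g) 0 j ⊗ delta_mx 0 j).
have rho_lin : linear rho.
  move=> a u v; rewrite /rho scaler_sumr -big_split; apply: eq_bigr => j _ /=.
  rewrite cotens_scale_pure -tens_pureDl; congr (_ ⊗ _).
  by rewrite map_mxD map_mxZ mulmxDl -scalemxAl !mxE.
pose rhoM := GRing.isLinear.Build _ _ _ _ rho rho_lin.
pose Rho : {linear V -> cotensor H V} := HB.pack rho rhoM.
have RhoC : is_coaction Rho.
  split=> v.
    rewrite [Rho v]/(rho v) /rho (balanced_sum _ _ (counit_scale_bal _)).
    rewrite [RHS](row_sum_delta (v : 'rV_n)); apply: eq_bigr => j _.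
    rewrite (tliftE (counit_scale_bal _)); congr (_ *: _).
    have : map_mx (counit H) (v^L *m g) = v.
      rewrite map_mxM g1 mulmx1; apply/matrixP=> a b.
      by rewrite !mxE counit_etaL.
    by move/matrixP/(_ 0 j); rewrite mxE.
  have rho_bal : balanced (fun (a : k) (x : H) => x * etaR H a)
      (fun (a : k) (w : V) => a *: w)
      (fun x w => x ⊗ Rho w : cotensor H (cotensor H V)).
    split=> [x x' w|x w w'|a x w]; first by rewrite tens_pureDl.
      by rewrite raddfD tens_pureDr.
    by rewrite linearZ tens_pure_bal.
  rewrite [Rho v in RHS]/(rho v) /rho [RHS](balanced_sum _ _ rho_bal).
  rewrite [Rho v]/(rho v) /rho.
  rewrite [LHS](balanced_sum _ _ (coprod_insert_bal V)).
  under [RHS]eq_bigr => i _ do rewrite (tliftE rho_bal).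
  transitivity (\sum_j coprod_insert ((v^L *m g) 0 j) (delta_mx 0 j : V)).
    by apply: eq_bigr => j _; apply: tliftE (coprod_insert_bal V) _ _.
  have rhoD i : Rho (delta_mx 0 i) = \sum_j (g i j ⊗ (delta_mx 0 j : V)).
    by apply: eq_bigr => j _; rewrite map_delta_mx -rowE mxE.
  under [RHS]eq_bigr => i _ do rewrite rhoD tens_pure_sumr.
  (* Both sides of coassociativity are the double sum of the (v^L g)_i (x) (g_ij (x) e_j). *)
  rewrite exchange_big; apply: eq_bigr => j _ /=; rewrite /coprod_insert.
  have -> : coprod H ((v^L *m g) 0 j) = \sum_i ((v^L *m g) 0 i ⊗ g i j : G2).
    have /matrixP/(_ 0 j) : map_mx (coprod H) (v^L *m g) = tmx (v^L *m g) g.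
      by rewrite coprod_mulL gg tmx_mulL.
    rewrite mxE => ->; rewrite mxE; apply: eq_bigr => i _.
    by rewrite rtens_split !mxE.
  rewrite (balanced_sum _ _ (cotens_insert_bal _)).
  by apply: eq_bigr => i _; rewrite (tliftE (cotens_insert_bal _)).
have [|x x0 xprim] := uH V Rho RhoC.
  exists (delta_mx 0 (Ordinal n0)); apply/eqP => /matrixP/(_ 0 (Ordinal n0))/eqP.
  by rewrite !mxE !eqxx oner_eq0.
exists x => //; apply/matrixP=> i j; rewrite ord1 => {i}.
pose phi (w : V) : k := w 0 j.
have phi_lin : scalar phi by move=> a u w; rewrite /phi !mxE.
pose phiM := GRing.isLinear.Build _ _ _ _ phi phi_lin.
pose Psi : {scalar V} := HB.pack phi phiM.
have <- : cotens_form Psi (Rho x) = x^R 0 j.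
  by rewrite xprim cotens_formE mul1r [RHS]mxE.
rewrite [Rho x]/(rho x) cotens_form_sum.
have PsiD l : Psi (delta_mx 0 l) = (l == j)%:R by rewrite /= /phi mxE eqxx eq_sym.
rewrite (bigD1 j) //= big1 => [|l lj]; rewrite cotens_formE PsiD.
  by rewrite eqxx rmorph1 mulr1 addr0.
by rewrite (negbTE lj) rmorph0 mulr0.
Qed.

(** In a basis of V the coaction becomes a matrix, the coaction axioms become the grouplike
    equations, and a primitive row lists the coordinates of a primitive vector. *)
Lemma has_primitive_unipotent :
    (forall n (g : 'M[H]_n), grouplike g -> (0 < n)%N -> has_primitive g) ->
  unipotent H.
Proof.
move=> primH V rho [rho1 rhoA] [v v0].
pose n := \dim {:V}; pose X : n.-tuple V := vbasis {:V}.
have Xbasis : basis_of {:V} X := vbasisP _.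
have Xfree : free X := basis_free Xbasis.
have n0 : (0 < n)%N.
  by rewrite lt0n dimv_eq0; apply: contraNneq v0 => V0; rewrite -memv0 -V0 memvf.
have repr_cotens (t : cotensor H V) : exists x : 'rV[H]_n, t = \sum_j x 0 j ⊗ X`_j.
  move: t; apply: tens_ind => [|y w t [x ->]].
    exists 0; rewrite big1 // => j _; rewrite mxE.
    by apply/tclassP/tens_eq0l.
  exists (\row_j (y * etaR H (coord X j w)) + x).
  rewrite (coord_basis Xbasis (memvf w)).
  rewrite tens_pure_sumr -big_split; apply: eq_bigr => j _ /=.
  rewrite -tens_pure_bal -tens_pureDl !mxE; congr ((y * etaR H _ + _) ⊗ _).
  rewrite linear_sum (bigD1 j) //= linearZ /= coord_free // eqxx mulr1 big1 ?addr0 //.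
  by move=> i ij; rewrite linearZ /= coord_free // (negbTE ij) mulr0.
have [f fP] := choice (fun i : 'I_n => repr_cotens (rho X`_i)).
pose g : 'M[H]_n := \matrix_i f i.
have rhoX (i : 'I_n) : rho X`_i = \sum_j g i j ⊗ X`_j.
  by rewrite fP; apply: eq_bigr => j _; rewrite mxE.
have coordX (i j : 'I_n) : coord X j X`_i = (i == j)%:R.
  by rewrite coord_free.
have sum_coord (j : 'I_n) (F : 'I_n -> k) : \sum_i F i * coord X j X`_i = F j.
  rewrite (bigD1 j) //= coordX eqxx mulr1 big1 ?addr0 // => i ij.
  by rewrite coordX (negbTE ij) mulr0.
have formX (j : 'I_n) (x : 'I_n -> H) : cotens_form (coord X j) (\sum_i x i ⊗ X`_i) = x j.
  rewrite cotens_form_sum (bigD1 j) //= cotens_formE /= coordX eqxx rmorph1 mulr1.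
  rewrite big1 ?addr0 // => i ij.
  by rewrite cotens_formE /= coordX (negbTE ij) rmorph0 mulr0.
have gG : grouplike g.
  split; apply/matrixP=> i j; last first.
    rewrite [LHS]mxE [RHS]mxE; have := congr1 (coord X j) (rho1 X`_i).
    rewrite rhoX (balanced_sum _ _ (counit_scale_bal _)) linear_sum coordX => <-.
    rewrite -[LHS](sum_coord j (fun l => counit H (g i l))); apply: eq_bigr => l _.
    by rewrite (tliftE (counit_scale_bal _)) linearZ.
  have rho_bal : balanced (fun (a : k) (x : H) => x * etaR H a)
      (fun (a : k) (w : V) => a *: w)
      (fun x w => x ⊗ rho w : cotensor H (cotensor H V)).
    split=> [x x' w|x w w'|a x w]; first by rewrite tens_pureDl.
      by rewrite raddfD tens_pureDr.
    by rewrite linearZ tens_pure_bal.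
  (* Applying id (x) id (x) coord_j to coassociativity at the i-th basis vector gives psi g_ij on
     the left and the sum of the g_il (x) g_lj on the right. *)
  have := congr1 (cotens_form2 (coord X j)) (rhoA X`_i).
  rewrite rhoX [X in cotens_form2 _ X = _](balanced_sum _ _ (coprod_insert_bal V)).
  rewrite [in RHS](balanced_sum _ _ rho_bal).
  rewrite !cotens_form2_sum.
  move=> E; transitivity (\sum_l coprod H (g i l) * rinr (etaR H (coord X j X`_l))).
    rewrite (bigD1 j) //= coordX eqxx !rmorph1 mulr1 big1 ?addr0 ?mxE // => l lj.
    by rewrite coordX (negbTE lj) !rmorph0 mulr0.
  transitivity (\sum_l cotens_form2 (coord X j)
      (tlift (coprod_insert (V := V)) (g i l ⊗ X`_l : cotensor H V))).
    apply: eq_bigr => l _.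
    by rewrite (tliftE (coprod_insert_bal V)) cotens_form2_insert.
  rewrite [LHS]E mxE; apply: eq_bigr => l _.
  by rewrite (tliftE rho_bal) cotens_form2E rhoX formX !mxE.
have [a a0 ag] := primH n g gG n0.
exists (\sum_i a 0 i *: X`_i).
  apply: contraNneq a0 => aX; apply/eqP/rowP=> j; rewrite mxE.
  rewrite -[LHS](sum_coord j (a 0)).
  transitivity (coord X j 0); last by rewrite linear0.
  by rewrite -[in RHS]aX linear_sum; apply: eq_bigr => i _; rewrite linearZ.
rewrite /primitive linear_sum.
have -> : \sum_i rho (a 0 i *: X`_i) = \sum_j (\sum_i etaL H (a 0 i) * g i j) ⊗ X`_j.
  under eq_bigr => i _ do rewrite linearZ /= rhoX scaler_sumr.
  rewrite exchange_big; apply: eq_bigr => j _ /=.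
  rewrite tens_pure_suml.
  by apply: eq_bigr => i _; rewrite cotens_scale_pure.
rewrite tens_pure_sumr.
apply: eq_bigr => j _; rewrite -tens_pure_bal mul1r; congr (_ ⊗ _).
have /matrixP/(_ 0 j) := ag; rewrite [X in _ = X]mxE => <-.
by rewrite [X in _ = X]mxE; apply: eq_bigr => i _; rewrite [a^L 0 i]mxE.
Qed.

End Comodules.

(** * Base change of grouplike matrices to Gamma' and conclusion *)

Lemma assoc_grouplike (k : fieldType) (H : hopfAlgebroid k) n (g : 'M[H]_n) :
  grouplike g -> grouplike (map_mx (assoc_proj H) g : 'M[assocHopf H]_n).
Proof.
case=> gg g1; split; apply/matrixP=> i j.
  have /matrixP/(_ i j) := gg; rewrite !mxE => E.
  transitivity (assoc_proj2 H (coprod H (g i j))); first exact: assoc_coprodE.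
  rewrite E raddf_sum; apply: eq_bigr => l _; rewrite !mxE.
  by rewrite -!rtens_split [LHS]assoc_proj2E.
have /matrixP/(_ i j) := g1; rewrite !mxE => <-; exact: assoc_counitE.
Qed.

Theorem theorem4p5 (k : fieldType) (H : hopfAlgebroid k) :
  unipotent (assocHopf H) -> unipotent H.
Proof.
move=> uH'; apply: has_primitive_unipotent => n g gg n0.
apply: irreducible_reduction gg n0 _ => {n g} n g gg n0 girr.
have [a a0 ag] := unipotent_has_primitive uH' (assoc_grouplike gg) n0.
apply: primitive_of_assoc_primitive girr gg a0 _ => j.
(* Primitivity over Gamma' says that the entries of a^L g - a^R project to zero. *)
apply: assoc_proj_kernel; apply/eqP; rewrite rmorphB subr_eq0; apply/eqP.
have /matrixP/(_ 0 j) := ag; rewrite !mxE => E.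
apply: etrans E; rewrite rmorph_sum; apply: eq_bigr => i _.
by rewrite rmorphM !mxE.
Qed.
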